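(* Let $T>0$, $0<\alpha\le1$, $0<\lambda<R$, and let $v_n,v\in B(R,\lambda,\alpha)$, $n=1,2,\dots$. If $v_n(x,t)$ converges to $v(x,t)$ pointwise in $\mathbb{R}\times[0,T]$ as $n\to\infty$, then $\Gamma_{[v_n]}(x,t,\xi,\tau)$ converges to $\Gamma_{[v]}(x,t,\xi,\tau)$ for any $(x,t),(\xi,\tau)\in\mathbb{R}\times[0,T]$ with $t>\tau$.
   Context: $\Omega_T=\mathbb{R}\times[0,T]$. For $\alpha\in(0,1]$, $C^{\alpha,\frac\alpha2}(\Omega_T)$ has norm $\|u\|_{\alpha,\frac\alpha2}=\sup_{\Omega_T}|u|+\sup_{(x,t)\ne(y,s)}\frac{|u(x,t)-u(y,s)|}{|x-y|^\alpha+|t-s|^{\alpha/2}}$. $B(R,\lambda,\alpha)$ is the set of $v=(a,b,c)$ with $a,b,c\in C^{\alpha,\frac\alpha2}(\Omega_T)$, $a\ge\lambda$, and $\|a\|_{\alpha,\frac\alpha2},\|b\|_{\alpha,\frac\alpha2},\|c\|_{\alpha,\frac\alpha2}<R$. For $v=(a,b,c)$, $\Gamma_{[v]}$ is the fundamental solution of $$\mathcal{L}_{[v]}u=u_t-a(x,t)u_{xx}+b(x,t)u_x+c(x,t)u=0$$ given by the parametrix construction: for $t>\tau$, $$Z_{[v]}(x,t,\xi,\tau)=\frac1{(4\pi a(\xi,\tau)(t-\tau))^{1/2}}e^{-\frac{(x-\xi)^2}{4a(\xi,\tau)(t-\tau)}},$$ $$(\mathcal{L}Z)_1(x,t,\xi,\tau)=(a(\xi,\tau)-a(x,t))\partial_x^2Z_{[v]}+b(x,t)\partial_xZ_{[v]}+c(x,t)Z_{[v]},$$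 $$(\mathcal{L}Z)_{m+1}(x,t,\xi,\tau)=\int_\tau^t\int_{\mathbb{R}}(\mathcal{L}Z)_1(x,t,y,\sigma)(\mathcal{L}Z)_m(y,\sigma,\xi,\tau)\,dy\,d\sigma\quad(m\ge1),$$ $$\phi_{[v]}=\sum_{m=1}^\infty(-1)^m(\mathcal{L}Z)_m,\qquad\Gamma_{[v]}(x,t,\xi,\tau)=Z_{[v]}(x,t,\xi,\tau)+\int_\tau^t\int_{\mathbb{R}}Z_{[v]}(x,t,y,\sigma)\phi_{[v]}(y,\sigma,\xi,\tau)\,dy\,d\sigma.$$ It is known that the series converges and $\Gamma_{[v]}$ is well defined. *)

(* Defs.v *)
From HB Require Import structures.
From mathcomp Require Import all_boot all_order all_algebra.
From mathcomp Require Import all_classical all_reals all_analysis.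
Import Order.TTheory GRing.Theory Num.Theory numFieldNormedType.Exports.

Set Implicit Arguments.
Unset Strict Implicit.
Unset Printing Implicit Defensive.

Local Open Scope classical_set_scope.
Local Open Scope ring_scope.

(* Functions on the strip are represented by total functions on R * R; only
   their values on the strip enter the notions below. *)
Definition strip (R : realType) (T : R) : set (R * R) :=
  [set p | 0 <= p.2 <= T].

Definition sup_norm (R : realType) (T : R) (u : R * R -> R) : \bar R :=
  ereal_sup [set `|u p|%:E | p in strip T].

Definition holder_seminorm (R : realType) (T alpha : R) (u : R * R -> R)
    : \bar R :=
  ereal_sup [set q | exists p1 p2 : R * R,
    [/\ strip T p1, strip T p2, p1 <> p2 &
        q = (`|u p1 - u p2| /
             (`|p1.1 - p2.1| `^ alpha + `|p1.2 - p2.2| `^ (alpha / 2)))%:E]].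

Definition holder_norm (R : realType) (T alpha : R) (u : R * R -> R) : \bar R :=
  (sup_norm T u + holder_seminorm T alpha u)%E.

Definition holder_space (R : realType) (T alpha : R) : set (R * R -> R) :=
  [set u | (holder_norm T alpha u < +oo)%E].

Record coeffs (R : realType) := Coeffs {
  coef_a : R * R -> R;
  coef_b : R * R -> R;
  coef_c : R * R -> R }.

Definition coeff_ball (R : realType) (T M lambda alpha : R)
    : set (coeffs R) :=
  [set v | [/\ holder_space T alpha (coef_a v),
               holder_space T alpha (coef_b v) &
               holder_space T alpha (coef_c v)] /\
           (forall p, strip T p -> lambda <= coef_a v p) /\
           [/\ (holder_norm T alpha (coef_a v) < M%:E)%E,
               (holder_norm T alpha (coef_b v) < M%:E)%E &
               (holder_norm T alpha (coef_c v) < M%:E)%E]].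

Definition Zker (R : realType) (v : coeffs R) (x t xi tau : R) : R :=
  (Num.sqrt (4 * pi * coef_a v (xi, tau) * (t - tau)))^-1 *
  expR (- ((x - xi) ^+ 2 / (4 * coef_a v (xi, tau) * (t - tau)))).

Definition LZ1 (R : realType) (v : coeffs R) (x t xi tau : R) : R :=
  (coef_a v (xi, tau) - coef_a v (x, t)) *
    derive1n 2 (fun z : R => Zker v z t xi tau) x +
  coef_b v (x, t) * derive1 (fun z : R => Zker v z t xi tau) x +
  coef_c v (x, t) * Zker v x t xi tau.

(* Space-time convolution; the open time interval avoids evaluating the
   kernels at coinciding times, and differs from the closed one by a null
   set. *)
Definition stconv (R : realType) (F G : R -> R -> R -> R -> R)
    (x t xi tau : R) : R :=
  \int[lebesgue_measure]_(sigma in `]tau, t[)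
    (\int[lebesgue_measure]_(y in [set: R])
       (F x t y sigma * G y sigma xi tau)).

(* The index is shifted: [LZ v m] is the iterate (LZ)_{m+1}. *)
Fixpoint LZ (R : realType) (v : coeffs R) (m : nat) : R -> R -> R -> R -> R :=
  if m is m'.+1 then stconv (LZ1 v) (LZ v m') else LZ1 v.

Definition phi (R : realType) (v : coeffs R) (x t xi tau : R) : R :=
  limn (series (fun m : nat => (-1) ^+ m.+1 * LZ v m x t xi tau)).

Definition Gamma (R : realType) (v : coeffs R) (x t xi tau : R) : R :=
  Zker v x t xi tau + stconv (Zker v) (phi v) x t xi tau.

(* Main.v *)
(** The kernel [LZ1] has a weakly singular Gaussian bound
    [B (t-tau)^(alpha/2-1) G(x-xi, t-tau)] with [B] uniform over the ball of
    coefficients, where [G(z, s) = s^(-1/2) exp(-z^2/(8Ms))].  Gaussians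
    reproduce under space convolution, and, once an exponential weight
    [exp(mu (t-tau))] with [mu] large is put in the bound, each time convolution
    with [LZ1] costs a factor at most [1/2].  Hence the iterates are bounded by a
    geometric sequence of such kernels, uniformly over the ball, and the limit
    [n -> oo] passes through the space and time integrals by dominated
    convergence and through the series by Tannery's theorem.  Dominated
    convergence needs the integrands to be measurable: this is carried along as
    joint measurability in the four variables, by Tonelli's theorem. *)
Require Import Defs.
From mathcomp Require Import all_boot all_order all_algebra.
From mathcomp Require Import all_classical all_reals all_analysis.
From mathcomp Require Import measurable_realfun ring lra.
Set Implicit Arguments.
Unset Strict Implicit.
Unset Printing Implicit Defensive.
Import Order.TTheory GRing.Theory Num.Theory numFieldNormedType.Exports.
Local Open Scope classical_set_scope.
Local Open Scope ring_scope.

(** * Integration and measurability *)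

(** The second space derivative of the parametrix has size [1/(t-tau)] times a Gaussian, which is
    not integrable in time. The factor [a(xi,tau) - a(x,t)] in front of it repairs this: by Hoelder
    continuity it gains [(t-tau)^(alpha/2)] on the parabolic scale. The leftover powers of
    [|x-xi|/sqrt(t-tau)] are absorbed by half of the Gaussian, whence [8 M] where the bound [a <= M]
    alone would give [4 M]. Tracked sharply, the time exponents of the iterates grow with [m] and
    bring in Gamma functions. Here the exponent stays [alpha/2 - 1] at every stage, the surplus
    power of time being bounded by a power of [T]. The price is a fixed constant per convolution,
    which a large [mu] outweighs. The same exponent, far from sharp there, is imposed on [Zker], so
    that a single limit lemma, [stconv_cvg], serves both the iterates and the integral in
    [Gamma]. *)

Lemma dominated_cvg_Rintegral d (T : measurableType d) (R : realType)
    (mu : {measure set T -> \bar R}) (D : set T) (f_ : nat -> T -> R)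
    (f g : T -> R) :
  measurable D -> (forall n, measurable_fun D (f_ n)) ->
  (forall x, D x -> f_ n x @[n --> \oo] --> f x) ->
  mu.-integrable D (EFin \o g) ->
  (forall n x, D x -> `|f_ n x| <= g x) ->
  \int[mu]_(x in D) f_ n x @[n --> \oo] --> \int[mu]_(x in D) f x.
Proof.
move=> mD mf_ f_f ig f_g.
have mf : measurable_fun D f by exact: measurable_fun_cvg f_f.
have [|||||intf _ cvgf] := @dominated_convergence _ _ _ mu D mD
    (fun n => EFin \o f_ n) (EFin \o f) (EFin \o g).
- by move=> n; exact/measurable_EFinP.
- exact/measurable_EFinP.
- by apply/aeW => x Dx; apply/fine_cvgP; split; [exact: nearW|exact: f_f].
- exact: ig.
- by apply/aeW => x n Dx /=; rewrite lee_fin; exact: f_g.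
- apply: fine_cvg; rewrite fineK//; exact: integrable_fin_num.
Qed.

(** Tonelli covers the positive and negative parts separately. Their difference is the integral by
    definition, so integrability of the sections does not enter. *)
Lemma measurable_Rintegral d (T : measurableType d) (R : realType)
    (f : T * R -> R) :
  measurable_fun setT f ->
  measurable_fun setT (fun x => \int[lebesgue_measure]_y f (x, y)).
Proof.
move=> mf; apply: measurableT_comp => //.
have mF : measurable_fun setT (EFin \o f) by exact/measurable_EFinP.
rewrite (_ : (fun x => _) = (fun x =>
   (\int[@lebesgue_measure R]_y ((EFin \o f)^\+)%E (x, y) -
    \int[@lebesgue_measure R]_y ((EFin \o f)^\-)%E (x, y))%E)).
  apply: emeasurable_funB.
    by apply: measurable_fun_fubini_tonelli_F => //; exact: measurable_funepos.
  by apply: measurable_fun_fubini_tonelli_F => //; exact: measurable_funeneg.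
apply/funext => x; rewrite integralE; congr (_ - _)%E.
  by apply: eq_integral => y _; rewrite !unlock.
by apply: eq_integral => y _; rewrite !unlock.
Qed.

(** Meant for [f] that blows up at the endpoints: the fundamental theorem is applied on closed
    subintervals exhausting the open one, and monotone convergence passes to the limit. Bounds on
    [F] replace its endpoint values. *)
Lemma ge0_FTC_le (R : realType) (f F : R -> R) (a b m M : R) :
  a < b -> {in `]a, b[, forall x, 0 <= f x} ->
  {in `]a, b[, continuous f} ->
  {in `]a, b[, forall x : R, is_derive x 1 F (f x)} ->
  {in `]a, b[, forall x, m <= F x <= M} ->
  (\int[lebesgue_measure]_(x in `]a, b[) (f x)%:E <= (M - m)%:E)%E.
Proof.
move=> ab f0 cf dF mFM.
(* Starting the denominators at 3 gives [2 * h i < b - a], so even the first subinterval is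
   nondegenerate. *)
pose h i : R := (b - a) / i.+3%:R.
have h0 i : 0 < h i by rewrite divr_gt0// subr_gt0.
have h2 i : 2 * h i < b - a.
  rewrite /h mulrA ltr_pdivrMr// mulrC ltr_pM2l ?subr_gt0//.
  by rewrite ltr_nat.
pose I i := `[a + h i, b - h i]%classic.
have subI i : I i `<=` `]a, b[.
  move=> x; rewrite /I /= !in_itv/= => /andP[ax xb].
  by have h0i := h0 i; apply/andP; split; lra.
have mf : measurable_fun `]a, b[ f.
  apply: open_continuous_measurable_fun => //.
  move=> x; rewrite inE => xab; exact: cf.
have -> : `]a, b[%classic = \bigcup_i I i.
  apply/seteqP; split=> [x|x [i _]]; last exact: subI.
  rewrite /= in_itv/= => /andP[ax xb].
  pose e := Num.min (x - a) (b - x).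
  have e0 : 0 < e by rewrite lt_min !subr_gt0 ax.
  exists (Num.truncn ((b - a) / e)) => //.
  have : h (Num.truncn ((b - a) / e)) <= e.
    rewrite /h ler_pdivrMr// -ler_pdivrMl//.
    rewrite mulrC (le_trans (ltW (truncnS_gt _)))// ler_nat.
    by do 2 apply: leqW.
  rewrite le_min => /andP[h1 h3]; rewrite /I /= in_itv/=.
  by apply/andP; split; lra.
have ndI : nondecreasing_seq I.
  apply/nondecreasing_seqP => n; apply/subsetPset => x.
  rewrite /I /= !in_itv/=.
  have : h n.+1 <= h n by rewrite /h ler_pM2l ?subr_gt0// lef_pV2 ?posrE// ler_nat.
  by move=> hn /andP[ax xb]; apply/andP; split; lra.
have cvgI := @ge0_nondecreasing_set_cvg_integral _ (measurableTypeR R) R I (EFin \o f)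
  lebesgue_measure ndI.
apply: (cvge_to_le (cvgI _ _ _)) => //.
- by move=> i; exact: measurable_itv.
- by move=> i; apply/measurable_EFinP; exact: measurable_funS mf.
- by move=> i x /subI xab; rewrite lee_fin f0.
apply: nearW => i; rewrite [leLHS](_ : _ = (F (b - h i))%:E - (F (a + h i))%:E)%E.
  have /andP[m1 M1] : m <= F (b - h i) <= M.
    by apply: mFM; rewrite in_itv/=; have h2i := h2 i; have h0i := h0 i; apply/andP; split; lra.
  have /andP[m2 M2] : m <= F (a + h i) <= M.
    by apply: mFM; rewrite in_itv/=; have h2i := h2 i; have h0i := h0 i; apply/andP; split; lra.
  by rewrite -EFinB lee_fin; lra.
have hab : a + h i < b - h i by have := h2 i; lra.
have cF : {within `[a + h i, b - h i], continuous F}.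
  apply: derivable_within_continuous => x xI.
  by have [] := dF _ (subI i x xI).
apply: continuous_FTC2 => //.
- by apply: continuous_in_subspaceT => x; rewrite inE => xI; exact/cf/(subI i).
- split => [x xI||].
  + by have [] := dF _ (subI i x (subset_itv_oo_cc xI)).
  + by have /continuous_within_itvP := cF; move=> /(_ hab)[].
  + by have /continuous_within_itvP := cF; move=> /(_ hab)[].
- move=> x xI; rewrite derive1E.
  by have [_ ->] := dF _ (subI i x (subset_itv_oo_cc xI)).
Qed.

Lemma rat_between (R : realType) (a b : R) : a < b ->
  exists q : rat, a < ratr q < b.
Proof. by move=> /rat_in_itvoo[q]; rewrite in_itv; exists q. Qed.

(** Continuity relative to [D] suffices because measurable sets of the plane are generated by
    rectangles: a superlevel set is the countable union of the traces on [D] of the rational boxes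
    that it contains. *)
Lemma measurable_fun_plane (R : realType) (D : set (R * R)) (f : R * R -> R) :
  measurable D ->
  (forall p e, D p -> 0 < e -> exists2 d, 0 < d & forall q, D q ->
     `|q.1 - p.1| < d -> `|q.2 - p.2| < d -> `|f q - f p| < e) ->
  measurable_fun D f.
Proof.
move=> mD cf _; apply: (measurability _ (RGenOInfty.measurableE R)) => //.
move=> _ [_ [c ->] <-].
pose box (k : (rat * rat) * (rat * rat)) : set (R * R) :=
  `]ratr k.1.1, ratr k.1.2[ `*` `]ratr k.2.1, ratr k.2.2[.
pose F k := if pselect (D `&` box k `<=` [set p | c < f p])
            then D `&` box k else set0.
rewrite (_ : _ `&` _ = \bigcup_k F k).
  apply: countable_bigcupT_measurable => // k; rewrite /F.
  case: pselect => /= ?; [apply: measurableI => //|by []].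
  by apply: measurableX; exact: measurable_itv.
apply/seteqP; split=> [p [Dp]|p [k _]]; last first.
  rewrite /F; case: pselect => /= kc Fp; [split; first by case: Fp|by []].
  by rewrite /= in_itv/= andbT; exact: kc.
rewrite /= in_itv/= andbT -subr_gt0 => cfp.
have [d d0 dP] := cf p _ Dp cfp.
have [q1 /andP[? ?]] := @rat_between _ (p.1 - d) p.1 ltac:(lra).
have [q2 /andP[? ?]] := @rat_between _ p.1 (p.1 + d) ltac:(lra).
have [q3 /andP[? ?]] := @rat_between _ (p.2 - d) p.2 ltac:(lra).
have [q4 /andP[? ?]] := @rat_between _ p.2 (p.2 + d) ltac:(lra).
have bp : box ((q1, q2), (q3, q4)) p.
  by split; rewrite /= in_itv/=; apply/andP; split.
exists ((q1, q2), (q3, q4)) => //; rewrite /F.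
case: pselect => /= [//|]; case=> q [Dq [/=]]; rewrite !in_itv/= => /andP[? ?] /andP[? ?].
have /(dP _ Dq) : `|q.1 - p.1| < d by rewrite ltr_norml; apply/andP; split; lra.
have /[swap] /[apply] : `|q.2 - p.2| < d.
  by rewrite ltr_norml; apply/andP; split; lra.
by rewrite ltr_norml => /andP[]; lra.
Qed.

(** Inverted, this is [y^p <= exp y], which holds since [y^p <= max(1, y) <= 1 + y]. It is the
    source of the small factor in [mu]. *)
Lemma expRN_le_powR (R : realType) (p y : R) : 0 < p <= 1 -> 0 < y ->
  expR (- y) <= y `^ (- p).
Proof.
move=> /andP[p0 p1] y0; rewrite expRN powRN lef_pV2 ?posrE ?expR_gt0 ?powR_gt0//.
have [y1|/ltW y1] := leP y 1.
  rewrite (@le_trans _ _ (1 `^ p))//.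
    by rewrite ge0_ler_powR ?nnegrE// ltW.
  rewrite powR1.
  by rewrite (le_trans _ (expR_ge1Dx y))// lerDl ltW.
rewrite (@le_trans _ _ y)//; first exact: ler1_powR.
by rewrite (le_trans _ (expR_ge1Dx y))// lerDr.
Qed.

(** The heat kernel of diffusivity [k/4] at time [s], without its normalising constant; its mass in
    [z] is [sqrt(pi k)] for positive [k] and [s]. *)
Definition gauss_kernel {R : realType} (k z s : R) : R :=
  (Num.sqrt s)^-1 * expR (- (z ^+ 2 / (k * s))).

Lemma gauss_kernel_ge0 (R : realType) (k z s : R) : 0 <= gauss_kernel k z s.
Proof. by rewrite mulr_ge0 ?expR_ge0// invr_ge0 sqrtr_ge0. Qed.

Section gauss_conv.
Context {R : realType} (k a b x xi : R).
Hypotheses (k0 : 0 < k) (a0 : 0 < a) (b0 : 0 < b).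

(** Standard deviation and mean of the normal density in [y] to which the product of the two
    Gaussians is proportional. *)
Let s := Num.sqrt (k * a * b / (2 * (a + b))).
Let m := (b * x + a * xi) / (a + b).

Let ab0 : 0 < a + b. Proof. by rewrite addr_gt0. Qed.

Let s2E : s ^+ 2 = k * a * b / (2 * (a + b)).
Proof. by rewrite sqr_sqrtr// divr_ge0// ?mulr_ge0// ltW. Qed.

Let s0 : s != 0.
Proof. by rewrite gt_eqF// sqrtr_gt0 divr_gt0// ?mulr_gt0. Qed.

(* Completing the square in [y]. *)
Lemma gauss_kernel_mulE (y : R) :
  gauss_kernel k (x - y) a * gauss_kernel k (y - xi) b =
  Num.sqrt (pi * k) * gauss_kernel k (x - xi) (a + b) * normal_pdf m s y.
Proof.
rewrite normal_pdfE// /normal_peak /normal_fun s2E /gauss_kernel.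
have -> : - (y - m) ^+ 2 / (k * a * b / (2 * (a + b)) *+ 2) =
  - ((x - y) ^+ 2 / (k * a)) - (y - xi) ^+ 2 / (k * b)
    + (x - xi) ^+ 2 / (k * (a + b)).
  by rewrite /m; field; rewrite !gt_eqF.
rewrite !expRD !expRN.
have -> : (Num.sqrt (k * a * b / (2 * (a + b)) * pi *+ 2))^-1 =
  (Num.sqrt (pi * k))^-1 * (Num.sqrt a)^-1 * (Num.sqrt b)^-1 * Num.sqrt (a + b).
  rewrite (_ : _ *+ 2 = (pi * k) * a * b / (a + b)); last first.
    by field; rewrite gt_eqF.
  rewrite !sqrtrM ?sqrtrV ?invfM ?invrK ?mulr_ge0 ?pi_ge0 ?ltW//.
field.
by rewrite !gt_eqF ?expR_gt0 ?sqrtr_gt0 ?mulr_gt0 ?pi_gt0.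
Qed.

Lemma integrable_gauss_kernel_mul : (@lebesgue_measure R).-integrable setT
  (fun y => (gauss_kernel k (x - y) a * gauss_kernel k (y - xi) b)%:E).
Proof.
under eq_fun do rewrite gauss_kernel_mulE EFinM.
by apply: integrableZl => //; exact: integrable_normal_pdf.
Qed.

(** The semigroup property of the heat kernel: the normal density has mass 1, and [sqrt(pi k)] makes
    up for the dropped normalisation. *)
Lemma Rintegral_gauss_kernel_mul :
  \int[lebesgue_measure]_y (gauss_kernel k (x - y) a * gauss_kernel k (y - xi) b)
  = Num.sqrt (pi * k) * gauss_kernel k (x - xi) (a + b).
Proof.
under eq_Rintegral do rewrite gauss_kernel_mulE.
rewrite RintegralZl//; last exact: integrable_normal_pdf.
by rewrite /Rintegral integral_normal_pdf mulr1.
Qed.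

End gauss_conv.

(** * The Beta integral *)

Lemma le0_ger_powR (R : realType) (p u v : R) : p <= 0 -> 0 < u -> u <= v ->
  v `^ p <= u `^ p.
Proof.
move=> p0 u0 uv; have v0 : 0 < v by exact: lt_le_trans uv.
rewrite -(opprK p) !(powRN _ (- p)) lef_pV2 ?posrE ?powR_gt0//.
by rewrite ge0_ler_powR ?nnegrE ?oppr_ge0// ltW.
Qed.

Lemma half_powR_le2 (R : realType) (p : R) : 0 <= p -> 2^-1 `^ (p - 1) <= 2 :> R.
Proof.
move=> p0; rewrite (@le_trans _ _ (2^-1 `^ (-1)))//.
  by rewrite ger_powR ?invr_gt0//=; [rewrite invf_le1//; lra|lra].
by rewrite powR_inv1 ?invr_ge0// invrK.
Qed.

Lemma is_derive_powR_rsub (R : realType) (p t s : R) : s < t ->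
  is_derive s 1 (fun r : R => (t - r) `^ p) (- (p * (t - s) `^ (p - 1))).
Proof.
move=> st; have ts0 : 0 < t - s by rewrite subr_gt0.
have dg : is_derive s 1 (fun r : R => t - r) (-1).
  by apply: is_derive_eq; rewrite add0r mul1r.
have := @is_derive1_comp _ (fun u => u `^ p) (fun r : R => t - r) s _ _
  (is_derive1_powR p ts0) dg.
by rewrite mulrN1.
Qed.

Lemma is_derive_powR_lsub (R : realType) (p t s : R) : t < s ->
  is_derive s 1 (fun r : R => (r - t) `^ p) (p * (s - t) `^ (p - 1)).
Proof.
move=> st; have ts0 : 0 < s - t by rewrite subr_gt0.
have dg : is_derive s 1 (fun r : R => r - t) 1.
  by apply: is_derive_eq; rewrite oppr0 addr0.
have := @is_derive1_comp _ (fun u => u `^ p) (fun r : R => r - t) s _ _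
  (is_derive1_powR p ts0) dg.
by rewrite mulr1.
Qed.

Lemma measurable_powR_mul (R : realType) (D : set R) (t tau p q : R) :
  measurable_fun D (fun s => (t - s) `^ p * (s - tau) `^ q).
Proof.
apply: measurable_funTS; apply: measurable_funM.
  apply: (@measurableT_comp _ _ _ _ _ _ (fun u : R => u `^ p)); first exact: measurable_powR.
  exact: measurable_funB.
apply: (@measurableT_comp _ _ _ _ _ _ (fun u : R => u `^ q)); first exact: measurable_powR.
exact: measurable_funB.
Qed.

(** A crude bound on the Beta function. Each antiderivative yields [1/g] or [1/d], and each 2 comes
    from freezing a factor at the midpoint, by [half_powR_le2]. *)
Lemma beta_integral_le (R : realType) (g d t tau : R) :
  0 < g <= 1 -> 0 < d <= 1 -> tau < t ->
  (\int[lebesgue_measure]_(s in `]tau, t[)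
     ((t - s) `^ (g - 1) * (s - tau) `^ (d - 1))%:E <=
   ((2 / g + 2 / d) * (t - tau) `^ (g + d - 1))%:E)%E.
Proof.
move=> /andP[g0 g1] /andP[d0 d1] taut.
have h0 : 0 < (t - tau) / 2 by rewrite divr_gt0// subr_gt0.
(* On each half of the interval the factor that stays away from its
   singularity is frozen at the midpoint. *)
pose cd := ((t - tau) / 2) `^ (d - 1); pose cg := ((t - tau) / 2) `^ (g - 1).
pose f s := cd * (t - s) `^ (g - 1) + cg * (s - tau) `^ (d - 1).
pose F s := - (cd / g) * (t - s) `^ g + cg / d * (s - tau) `^ d.
have cd0 : 0 <= cd by exact: powR_ge0.
have cg0 : 0 <= cg by exact: powR_ge0.
have g0' := ltW g0; have d0' := ltW d0.
have f0 s : 0 <= f s by rewrite addr_ge0// mulr_ge0 ?powR_ge0.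
have fle s : s \in `]tau, t[ -> (t - s) `^ (g - 1) * (s - tau) `^ (d - 1) <= f s.
  rewrite in_itv/= => /andP[taus st].
  have [sm|ms] := leP (s - tau) ((t - tau) / 2).
    rewrite /f (@le_trans _ _ (cg * (s - tau) `^ (d - 1)))//.
      by rewrite ler_wpM2r ?powR_ge0// le0_ger_powR//; lra.
    by rewrite lerDr mulr_ge0 ?powR_ge0.
  rewrite /f mulrC (@le_trans _ _ (cd * (t - s) `^ (g - 1)))//.
    by rewrite ler_wpM2r ?powR_ge0// le0_ger_powR//; lra.
  by rewrite lerDl mulr_ge0 ?powR_ge0.
have dF : {in `]tau, t[, forall s : R, is_derive s 1 F (f s)}.
  move=> s; rewrite in_itv/= => /andP[taus st].
  have ? := @is_derive_powR_rsub _ g t s st.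
  have ? := @is_derive_powR_lsub _ d tau s taus.
  rewrite /F; apply: is_derive_eq.
  by rewrite /f /GRing.scale/=; field; rewrite !gt_eqF.
have df : {in `]tau, t[, forall s : R, derivable f s 1}.
  move=> s; rewrite in_itv/= => /andP[taus st].
  have ? := @is_derive_powR_rsub _ (g - 1) t s st.
  have ? := @is_derive_powR_lsub _ (d - 1) tau s taus.
  by rewrite /f; apply: ex_derive.
have cf : {in `]tau, t[, continuous f}.
  by move=> s /df /derivable1_diffP /differentiable_continuous.
have mf : measurable_fun `]tau, t[ f.
  apply: open_continuous_measurable_fun => //.
  by move=> s; rewrite inE => sI; exact: cf.
have e1 : cd * (t - tau) `^ g <= 2 * (t - tau) `^ (g + d - 1).
  rewrite /cd mulrC powRM ?invr_ge0//; last by rewrite subr_ge0 ltW.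
  rewrite mulrA -powRD; last by rewrite subr_eq0 (gt_eqF taut) implybT.
  by rewrite addrA mulrC ler_wpM2r ?powR_ge0// half_powR_le2// ltW.
have e2 : cg * (t - tau) `^ d <= 2 * (t - tau) `^ (g + d - 1).
  rewrite /cg mulrC powRM ?invr_ge0//; last by rewrite subr_ge0 ltW.
  rewrite mulrA -powRD; last by rewrite subr_eq0 (gt_eqF taut) implybT.
  rewrite addrA (addrC d g) mulrC ler_wpM2r ?powR_ge0//.
  by rewrite half_powR_le2// ltW.
apply: (@le_trans _ _ (\int[lebesgue_measure]_(s in `]tau, t[) (f s)%:E)%E).
  apply: ge0_le_integral => //.
  - by move=> s _; rewrite lee_fin mulr_ge0 ?powR_ge0.
  - by apply/measurable_EFinP; exact: measurable_powR_mul.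
  - exact/measurable_EFinP.
(* The two terms of [F] have opposite signs, so [F] lies between its values at the endpoints: only
   the first term survives at [tau], only the second at [t]. *)
apply: (@le_trans _ _
    (cg / d * (t - tau) `^ d - - (cd / g * (t - tau) `^ g))%:E).
  apply: (@ge0_FTC_le _ f F) => //.
  - move=> s; rewrite in_itv/= => /andP[taus st].
    have h1 : 0 <= cd / g * (t - s) `^ g <= cd / g * (t - tau) `^ g.
      rewrite mulr_ge0 ?powR_ge0 ?divr_ge0//=.
      by rewrite ler_wpM2l ?divr_ge0// ge0_ler_powR ?nnegrE//; lra.
    have h2 : 0 <= cg / d * (s - tau) `^ d <= cg / d * (t - tau) `^ d.
      rewrite mulr_ge0 ?powR_ge0 ?divr_ge0//=.
      by rewrite ler_wpM2l ?divr_ge0// ge0_ler_powR ?nnegrE//; lra.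
    by rewrite /F mulNr; move/andP: h1 => []; move/andP: h2 => [] ????; apply/andP; split; lra.
rewrite lee_fin opprK mulrDl addrC.
rewrite !(mulrAC _ _^-1) lerD// ler_wpM2r ?invr_ge0//.
Qed.

Lemma integrable_beta (R : realType) (g d t tau : R) :
  0 < g <= 1 -> 0 < d <= 1 -> tau < t ->
  (@lebesgue_measure R).-integrable `]tau, t[
     (fun s => ((t - s) `^ (g - 1) * (s - tau) `^ (d - 1))%:E).
Proof.
move=> g01 d01 taut; apply/integrableP; split.
  by apply/measurable_EFinP; exact: measurable_powR_mul.
apply: (@le_lt_trans _ _ ((2 / g + 2 / d) * (t - tau) `^ (g + d - 1))%:E);
  last exact: ltry.
under eq_integral do rewrite gee0_abs ?lee_fin ?mulr_ge0 ?powR_ge0//.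
exact: beta_integral_le.
Qed.

Lemma Rintegral_beta_le (R : realType) (g d t tau : R) :
  0 < g <= 1 -> 0 < d <= 1 -> tau < t ->
  \int[lebesgue_measure]_(s in `]tau, t[)
     ((t - s) `^ (g - 1) * (s - tau) `^ (d - 1)) <=
  (2 / g + 2 / d) * (t - tau) `^ (g + d - 1).
Proof.
move=> g01 d01 taut.
rewrite -lee_fin fineK; first exact: beta_integral_le.
by apply: integrable_fin_num => //; exact: integrable_beta.
Qed.

(** * Space-time kernels *)

Lemma le_Rintegral_bound d (T : measurableType d) (R : realType)
    (mu : {measure set T -> \bar R}) (D : set T) (f g : T -> R) :
  measurable D -> measurable_fun D f -> mu.-integrable D (EFin \o g) ->
  (forall x, D x -> `|f x| <= g x) ->
  `|\int[mu]_(x in D) f x| <= \int[mu]_(x in D) g x.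
Proof.
move=> mD mf ig fg.
have if_ : mu.-integrable D (EFin \o f).
  apply: (le_integrable mD _ _ ig); first exact/measurable_EFinP.
  by move=> x Dx /=; rewrite lee_fin (le_trans (fg _ Dx))// ler_norm.
apply: (le_trans (le_normr_Rintegral mD if_)).
apply: le_Rintegral => //.
by have := integrable_norm if_.
Qed.

Section gauss_bounded.
Context {R : realType} (k a b x xi A B : R).
Hypotheses (k0 : 0 < k) (a0 : 0 < a) (b0 : 0 < b).

Let integrable_bound : (@lebesgue_measure R).-integrable setT (EFin \o (fun y =>
  A * B * (gauss_kernel k (x - y) a * gauss_kernel k (y - xi) b))).
Proof.
rewrite (_ : _ \o _ = (fun y => (A * B)%:E *
  (gauss_kernel k (x - y) a * gauss_kernel k (y - xi) b)%:E)%E).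
  by apply: integrableZl => //; exact: integrable_gauss_kernel_mul.
by apply/funext => y /=; rewrite EFinM.
Qed.

Let mul_bound (f g : R -> R) y :
  `|f y| <= A * gauss_kernel k (x - y) a ->
  `|g y| <= B * gauss_kernel k (y - xi) b ->
  `|f y * g y| <=
    A * B * (gauss_kernel k (x - y) a * gauss_kernel k (y - xi) b).
Proof. by move=> fA gB; rewrite normrM mulrACA ler_pM. Qed.

Lemma gauss_bounded_le (f g : R -> R) :
  measurable_fun setT f -> measurable_fun setT g ->
  (forall y, `|f y| <= A * gauss_kernel k (x - y) a) ->
  (forall y, `|g y| <= B * gauss_kernel k (y - xi) b) ->
  `|\int[lebesgue_measure]_y (f y * g y)| <=
    A * B * (Num.sqrt (pi * k) * gauss_kernel k (x - xi) (a + b)).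
Proof.
move=> mf mg fA gB.
apply: (le_trans (@le_Rintegral_bound _ _ R lebesgue_measure setT
  (fun y => f y * g y) _ _ _ integrable_bound _)) => //.
- exact: measurable_funM.
- by move=> y _; exact: mul_bound.
- rewrite RintegralZl//; last exact: integrable_gauss_kernel_mul.
  by rewrite Rintegral_gauss_kernel_mul.
Qed.

Lemma gauss_bounded_cvg (f_ g_ : nat -> R -> R) (f g : R -> R) :
  (forall n, measurable_fun setT (f_ n)) ->
  (forall n, measurable_fun setT (g_ n)) ->
  (forall n y, `|f_ n y| <= A * gauss_kernel k (x - y) a) ->
  (forall n y, `|g_ n y| <= B * gauss_kernel k (y - xi) b) ->
  (forall y, f_ n y @[n --> \oo] --> f y) ->
  (forall y, g_ n y @[n --> \oo] --> g y) ->
  \int[lebesgue_measure]_y (f_ n y * g_ n y) @[n --> \oo] -->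
  \int[lebesgue_measure]_y (f y * g y).
Proof.
move=> mf mg fA gB cf cg.
apply: (dominated_cvg_Rintegral _ _ _ integrable_bound) => [//|n|y _|n y _].
- by apply: (@measurable_funM _ _ _ _ (f_ n) (g_ n)).
- by apply: cvgM.
- exact: mul_bound.
Qed.

End gauss_bounded.

Section spacetime_kernels.
Context {R : realType}.
Implicit Types (T k be mu B x t xi tau : R) (K L : R -> R -> R -> R -> R).

(** The first pair is [(x, t)], the second [(xi, tau)]. *)
Definition past T : set ((R * R) * (R * R)) :=
  [set z | [&& 0 <= z.2.2, z.2.2 < z.1.2 & z.1.2 <= T]].

Definition spacetime_measurable T K :=
  measurable_fun (past T) (fun z => K z.1.1 z.1.2 z.2.1 z.2.2).

(** The space integral of [gauss_kernel] does not depend on [t - tau], so [be > 0] is exactly what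
    makes the bound integrable in time. *)
Definition kernel_bound T k be mu B K := forall x t xi tau,
  0 <= tau -> tau < t -> t <= T -> `|K x t xi tau| <=
  B * expR (mu * (t - tau)) * (t - tau) `^ (be - 1) *
  gauss_kernel k (x - xi) (t - tau).

(* Outside [past T] the kernels are unconstrained (division by zero, values of
   the coefficients off the strip), so they are cut off to [0] there before
   Tonelli's theorem is applied on the whole space. *)
Lemma measurable_past T : measurable (past T).
Proof.
have m12 : measurable_fun setT (fun z : (R * R) * (R * R) => z.1.2).
  exact: (measurableT_comp measurable_snd measurable_fst).
have m22 : measurable_fun setT (fun z : (R * R) * (R * R) => z.2.2).
  exact: (measurableT_comp measurable_snd measurable_snd).
have mb : measurable_fun setT (fun z : (R * R) * (R * R) =>
    [&& 0 <= z.2.2, z.2.2 < z.1.2 & z.1.2 <= T]).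
  apply: measurable_and; first exact: measurable_fun_ler.
  by apply: measurable_and; [exact: measurable_fun_ltr|exact: measurable_fun_ler].
by rewrite -[past T]setTI; exact: (mb measurableT [set true]).
Qed.

Let restr T K := (fun z : (R * R) * (R * R) => K z.1.1 z.1.2 z.2.1 z.2.2) \_ (past T).

Let measurable_restr T K : spacetime_measurable T K -> measurable_fun setT (restr T K).
Proof.
by move=> mK; apply/(measurable_restrictT _ (measurable_past T)).
Qed.

Let restrE T K x t xi tau : 0 <= tau -> tau < t -> t <= T ->
  restr T K ((x, t), (xi, tau)) = K x t xi tau.
Proof.
by move=> tau0 taut tT; rewrite /restr patchE mem_set// /past/= tau0 taut tT.
Qed.

(** [w] lists the endpoints, the intermediate time and the intermediate point, in this order, so
    that space and then time can be integrated out as last components. *)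
Let restr_mul T K L (w : ((R * R) * (R * R)) * R * R) :=
  restr T K (w.1.1.1, (w.2, w.1.2)) * restr T L ((w.2, w.1.2), w.1.1.2).

Let measurable_restr_mul T K L : spacetime_measurable T K -> spacetime_measurable T L ->
  measurable_fun setT (restr_mul T K L).
Proof.
move=> /measurable_restr mK /measurable_restr mL.
have m1 : measurable_fun setT (fun w : ((R * R) * (R * R)) * R * R => (w.2, w.1.2)).
  apply: measurable_fun_pair; first exact: measurable_snd.
  exact: (measurableT_comp measurable_snd measurable_fst).
have m2 : measurable_fun setT (fun w : ((R * R) * (R * R)) * R * R => w.1.1.1).
  apply: (measurableT_comp measurable_fst).
  exact: (measurableT_comp measurable_fst measurable_fst).
have m3 : measurable_fun setT (fun w : ((R * R) * (R * R)) * R * R => w.1.1.2).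
  apply: (measurableT_comp measurable_snd).
  exact: (measurableT_comp measurable_fst measurable_fst).
apply: measurable_funM.
  exact: (measurableT_comp mK (measurable_fun_pair m2 m1)).
exact: (measurableT_comp mL (measurable_fun_pair m1 m3)).
Qed.

Let space_int T K L z s := \int[lebesgue_measure]_y restr_mul T K L ((z, s), y).

Let measurable_space_int T K L : spacetime_measurable T K -> spacetime_measurable T L ->
  measurable_fun setT (fun w => space_int T K L w.1 w.2).
Proof.
move=> mK mL; rewrite (_ : (fun w => _) = (fun w =>
    \int[lebesgue_measure]_y restr_mul T K L (w, y))).
  by apply: measurable_Rintegral; exact: measurable_restr_mul.
by apply/funext => -[z s].
Qed.

Let space_intE T K L x t xi tau s : 0 <= tau -> tau < s -> s < t -> t <= T ->
  space_int T K L ((x, t), (xi, tau)) s =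
  \int[lebesgue_measure]_y (K x t y s * L y s xi tau).
Proof.
move=> tau0 taus st tT; apply: eq_Rintegral => y _.
have s0 : 0 <= s by rewrite (le_trans tau0)// ltW.
have sT : s <= T by rewrite (le_trans (ltW st)).
by rewrite /restr_mul/= !restrE.
Qed.

Lemma measurable_space_conv T K L x t xi tau :
  spacetime_measurable T K -> spacetime_measurable T L -> 0 <= tau -> t <= T ->
  measurable_fun `]tau, t[
    (fun s => \int[lebesgue_measure]_y (K x t y s * L y s xi tau)).
Proof.
move=> mK mL tau0 tT.
apply: (eq_measurable_fun (space_int T K L ((x, t), (xi, tau)))).
  move=> s; rewrite inE/= in_itv/= => /andP[taus st].
  by rewrite space_intE// (lt_trans taus).
apply: measurable_funTS.
exact: (measurable_fun_pair2 _ (measurable_space_int mK mL)).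
Qed.

(** The cut-offs make the product vanish unless [tau < s < t]. The time integral thus extends to the
    whole line, its domain no longer depends on the parameters, and Tonelli applies twice. *)
Lemma measurable_stconv T K L : spacetime_measurable T K -> spacetime_measurable T L ->
  spacetime_measurable T (stconv K L).
Proof.
move=> mK mL.
apply: (eq_measurable_fun (fun z => \int[lebesgue_measure]_s space_int T K L z s)).
  move=> [[x t] [xi tau]]; rewrite inE /past/= => /and3P[tau0 taut tT].
  rewrite /stconv [RHS]Rintegral_mkcond; apply: eq_Rintegral => s _.
  have [sI|/negP sI] := boolP (s \in `]tau, t[).
    rewrite patchE mem_set//; move: sI; rewrite in_itv/= => /andP[taus st].
    by rewrite space_intE.
  rewrite patchE memNset//; rewrite /space_int (_ : (fun y => _) = cst 0).
    by rewrite Rintegral_cst// mul0r.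
  apply/funext => y; rewrite /restr_mul/= /restr !patchE.
  case: ifPn => [|_]; last by rewrite mul0r.
  case: ifPn => [|_]; last by rewrite mulr0.
  rewrite !inE /past/= => /and3P[_ taus _] /and3P[_ st _].
  by exfalso; apply: sI; rewrite in_itv/= taus st.
apply: measurable_funTS.
exact: (measurable_Rintegral (measurable_space_int mK mL)).
Qed.

Lemma spacetime_measurable_l T K x t s : spacetime_measurable T K ->
  0 <= s -> s < t -> t <= T -> measurable_fun setT (fun y => K x t y s).
Proof.
move=> /measurable_restr mK s0 st tT.
rewrite (_ : (fun y => _) = restr T K \o (fun y => ((x, t), (y, s)))).
  apply: measurableT_comp => //.
  by apply: measurable_fun_pair => //; exact: measurable_fun_pair.
by apply/funext => y /=; rewrite restrE.
Qed.

Lemma spacetime_measurable_r T K xi tau s : spacetime_measurable T K ->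
  0 <= tau -> tau < s -> s <= T -> measurable_fun setT (fun y => K y s xi tau).
Proof.
move=> /measurable_restr mK tau0 taus sT.
rewrite (_ : (fun y => _) = restr T K \o (fun y => ((y, s), (xi, tau)))).
  apply: measurableT_comp => //.
  by apply: measurable_fun_pair => //; exact: measurable_fun_pair.
by apply/funext => y /=; rewrite restrE.
Qed.

End spacetime_kernels.

(** * Estimates and limits for space-time convolutions *)

Section stconv_bounds.
Context {R : realType} (T k be mu : R).
Hypotheses (k0 : 0 < k) (be01 : 0 < be <= 1) (mu0 : 0 < mu).
Implicit Types (K L : R -> R -> R -> R -> R) (B BK BL x t xi tau s : R).

Let be0 : 0 < be. Proof. by case/andP: be01. Qed.

Let be201 : 0 < be / 2 <= 1.
Proof. by move: be01 => /andP[? ?]; apply/andP; split; lra. Qed.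

(* Trades the decay of the weight [exp(-mu (t-s))] for half of the integrable
   time exponent, which gains the small factor [mu^(-be/2)]. *)
Lemma expR_weight_split t tau s : s < t ->
  expR (mu * (s - tau)) <=
  expR (mu * (t - tau)) * (mu `^ (- (be / 2)) * (t - s) `^ (- (be / 2))).
Proof.
move=> st; rewrite (_ : mu * (s - tau) = mu * (t - tau) - mu * (t - s)); last by ring.
have ts0 : 0 < t - s by rewrite subr_gt0.
have mu0' := ltW mu0; have ts0' := ltW ts0.
rewrite expRD ler_wpM2l ?expR_ge0// -powRM// expRN_le_powR//.
by rewrite mulr_gt0.
Qed.

(** The majorant in the intermediate time, once space is integrated out. The exponent at [s = t] is
    [be/2 - 1] instead of [be - 1]: half of [be] pays for the factor [mu^(-be/2)], and the other
    half keeps the singularity integrable. *)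
Let profile B x t xi tau s := B * (mu `^ (- (be / 2)) *
  expR (mu * (t - tau)) * Num.sqrt (pi * k) * gauss_kernel k (x - xi) (t - tau)) *
  ((t - s) `^ (be / 2 - 1) * (s - tau) `^ (be - 1)).

Let space_conv_le K L BK BL x t xi tau s :
  spacetime_measurable T K -> spacetime_measurable T L -> 0 <= BK -> 0 <= BL ->
  kernel_bound T k be 0 BK K -> kernel_bound T k be mu BL L ->
  0 <= tau -> tau < s -> s < t -> t <= T ->
  `|\int[lebesgue_measure]_y (K x t y s * L y s xi tau)| <=
  profile (BK * BL) x t xi tau s.
Proof.
move=> mK mL BK0 BL0 bK bL tau0 taus st tT.
have s0 : 0 <= s by rewrite (le_trans tau0)// ltW.
have sT : s <= T by rewrite (le_trans (ltW st)).
have ts0 : 0 < t - s by rewrite subr_gt0.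
have staus0 : 0 < s - tau by rewrite subr_gt0.
have := @gauss_bounded_le R k (t - s) (s - tau) x xi
  (BK * (t - s) `^ (be - 1)) (BL * expR (mu * (s - tau)) * (s - tau) `^ (be - 1))
  k0 ts0 staus0 (fun y => K x t y s) (fun y => L y s xi tau)
  (spacetime_measurable_l x mK s0 st tT) (spacetime_measurable_r xi mL tau0 taus sT).
rewrite (_ : t - s + (s - tau) = t - tau); last by ring.
move=> /(_ _ _)/le_trans; apply.
- by move=> y; have := bK x t y s s0 st tT; rewrite mul0r expR0 mulr1.
- by move=> y; exact: bL.
rewrite /profile (_ : be / 2 - 1 = - (be / 2) + (be - 1)); last by lra.
rewrite [(t - s) `^ (_ + (be - 1))]powRD; last by rewrite (gt_eqF ts0) implybT.
set E := expR (mu * (t - tau)); set G := gauss_kernel _ _ _.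
rewrite [leLHS](_ : _ = expR (mu * (s - tau)) * (BK * BL * (t - s) `^ (be - 1) *
   (s - tau) `^ (be - 1) * (Num.sqrt (pi * k) * G))); last by ring.
rewrite [leRHS](_ : _ = E * (mu `^ (- (be / 2)) * (t - s) `^ (- (be / 2))) *
  (BK * BL * (t - s) `^ (be - 1) *
   (s - tau) `^ (be - 1) * (Num.sqrt (pi * k) * G))); last by ring.
rewrite ler_wpM2r ?expR_weight_split//.
by rewrite !mulr_ge0 ?powR_ge0 ?sqrtr_ge0 ?gauss_kernel_ge0.
Qed.

Let integrable_profile B x t xi tau : tau < t ->
  (@lebesgue_measure R).-integrable `]tau, t[ (EFin \o profile B x t xi tau).
Proof.
move=> taut; rewrite (_ : _ \o _ = (fun s => (B * (mu `^ (- (be / 2)) *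
  expR (mu * (t - tau)) * Num.sqrt (pi * k) * gauss_kernel k (x - xi) (t - tau)))%:E *
  ((t - s) `^ (be / 2 - 1) * (s - tau) `^ (be - 1))%:E)%E).
  by apply: integrableZl => //; exact: integrable_beta.
by apply/funext => s /=; rewrite EFinM.
Qed.

(** The factors come from the Gaussian semigroup property, from the Beta bound
    ([2/(be/2) + 2/be = 6/be]), and from the power of time discarded to return to exponent
    [be - 1]. *)
Definition stconv_const : R :=
  Num.sqrt (pi * k) * (6 / be) * T `^ (be / 2).

(** The time convolution produces the exponent [be/2 + (be - 1)]. Its first part is at most
    [T^(be/2)], so the bound keeps its shape and can be iterated; only the constant changes. *)
Lemma kernel_bound_stconv K L BK BL :
  spacetime_measurable T K -> spacetime_measurable T L -> 0 <= BK -> 0 <= BL ->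
  kernel_bound T k be 0 BK K -> kernel_bound T k be mu BL L ->
  kernel_bound T k be mu (BK * BL * stconv_const * mu `^ (- (be / 2))) (stconv K L).
Proof.
move=> mK mL BK0 BL0 bK bL x t xi tau tau0 taut tT.
apply: (@le_trans _ _
  (\int[lebesgue_measure]_(s in `]tau, t[) profile (BK * BL) x t xi tau s)).
  apply: le_Rintegral_bound => //.
  - exact: measurable_space_conv mK mL tau0 tT.
  - exact: integrable_profile.
  - by move=> s; rewrite /= in_itv/= => /andP[taus st]; exact: space_conv_le.
rewrite /profile RintegralZl//; last exact: integrable_beta.
set C := BK * BL * _.
have C0 : 0 <= C.
  by rewrite !mulr_ge0 ?powR_ge0 ?expR_ge0 ?sqrtr_ge0 ?gauss_kernel_ge0.
have tt0 : 0 < t - tau by rewrite subr_gt0.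
apply: (@le_trans _ _ (C * ((6 / be) * (T `^ (be / 2) * (t - tau) `^ (be - 1))))).
  rewrite ler_wpM2l//; apply: le_trans (Rintegral_beta_le be201 be01 taut) _.
  rewrite (_ : 2 / (be / 2) + 2 / be = 6 / be); last by field; rewrite gt_eqF.
  have be0' := ltW be0; rewrite ler_wpM2l ?divr_ge0// (_ : _ - 1 = be / 2 + (be - 1)); last by ring.
  rewrite [_ `^ (_ + (be - 1))]powRD; last by rewrite (gt_eqF tt0) implybT.
  rewrite ler_wpM2r ?powR_ge0// ge0_ler_powR ?nnegrE//; last 1 first.
  - by rewrite lerBlDr (le_trans tT)// lerDl.
  - by rewrite divr_ge0// ltW.
  - exact: ltW.
  - by rewrite (le_trans _ tT)// (le_trans tau0)// ltW.
by rewrite /C /stconv_const le_eqVlt; apply/orP; left; apply/eqP; ring.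
Qed.

(** Dominated convergence twice: in space with a product of Gaussians at fixed [s], then in time
    with [profile]. The majorants are independent of [n] because [BK] and [BL] are. *)
Lemma stconv_cvg (K_ L_ : nat -> R -> R -> R -> R -> R) K L BK BL x t xi tau :
  (forall n, spacetime_measurable T (K_ n)) ->
  (forall n, spacetime_measurable T (L_ n)) -> 0 <= BK -> 0 <= BL ->
  (forall n, kernel_bound T k be 0 BK (K_ n)) ->
  (forall n, kernel_bound T k be mu BL (L_ n)) ->
  0 <= tau -> tau < t -> t <= T ->
  (forall y s, 0 <= s -> s < t -> K_ n x t y s @[n --> \oo] --> K x t y s) ->
  (forall y s, tau < s -> s <= T ->
    L_ n y s xi tau @[n --> \oo] --> L y s xi tau) ->
  stconv (K_ n) (L_ n) x t xi tau @[n --> \oo] --> stconv K L x t xi tau.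
Proof.
move=> mK mL BK0 BL0 bK bL tau0 taut tT cK cL.
apply: (dominated_cvg_Rintegral _ _ _ (integrable_profile (BK * BL) x xi taut)).
- by [].
- by move=> n; exact: measurable_space_conv (mK n) (mL n) tau0 tT.
- move=> s; rewrite /= in_itv/= => /andP[taus st].
  have s0 : 0 <= s by rewrite (le_trans tau0)// ltW.
  have sT : s <= T by rewrite (le_trans (ltW st)).
  have ts0 : 0 < t - s by rewrite subr_gt0.
  have staus0 : 0 < s - tau by rewrite subr_gt0.
  apply: (@gauss_bounded_cvg R k (t - s) (s - tau) x xi
    (BK * (t - s) `^ (be - 1)) (BL * expR (mu * (s - tau)) * (s - tau) `^ (be - 1))
    k0 ts0 staus0 (fun n y => K_ n x t y s) (fun n y => L_ n y s xi tau)).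
  + by move=> n; exact: spacetime_measurable_l (mK n) _ _ _.
  + by move=> n; exact: spacetime_measurable_r (mL n) _ _ _.
  + by move=> n y; have := bK n x t y s s0 st tT; rewrite mul0r expR0 mulr1.
  + by move=> n y; exact: bL.
  + by move=> y; exact: cK.
  + by move=> y; exact: cL.
- move=> n s; rewrite /= in_itv/= => /andP[taus st].
  exact: space_conv_le.
Qed.

End stconv_bounds.

(** * The parametrix and its first residual *)

Section holder_facts.
Context {R : realType} (T M alpha : R).
Hypotheses (T0 : 0 < T) (alpha0 : 0 < alpha).

Let den (p q : R * R) :=
  `|p.1 - q.1| `^ alpha + `|p.2 - q.2| `^ (alpha / 2).

Let den_ge0 p q : 0 <= den p q.
Proof. by rewrite addr_ge0 ?powR_ge0. Qed.

Let den_gt0 p q : p <> q -> 0 < den p q.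
Proof.
case: p q => [p1 p2] [q1 q2] pq; rewrite /den/=.
have [p1q1|p1q1] := eqVneq p1 q1; last first.
  by rewrite ltr_pwDl ?powR_ge0// powR_gt0// normr_gt0 subr_eq0.
have [p2q2|p2q2] := eqVneq p2 q2; first by case: pq; rewrite p1q1 p2q2.
by rewrite ltr_pwDr ?powR_ge0// powR_gt0// normr_gt0 subr_eq0.
Qed.

Let strip0 (x : R) : strip T (x, 0).
Proof. by rewrite /strip/= lexx ltW. Qed.

Let sup_norm_ge (u : R * R -> R) p : strip T p -> (`|u p|%:E <= sup_norm T u)%E.
Proof. by move=> Tp; apply: ereal_sup_ubound; exists p. Qed.

Let seminorm_ge (u : R * R -> R) p q : strip T p -> strip T q -> p <> q ->
  ((`|u p - u q| / den p q)%:E <= holder_seminorm T alpha u)%E.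
Proof. by move=> Tp Tq pq; apply: ereal_sup_ubound; exists p, q. Qed.

Let sup_norm_ge0 (u : R * R -> R) : (0 <= sup_norm T u)%E.
Proof. by apply: le_trans (sup_norm_ge u (strip0 0)); rewrite lee_fin. Qed.

(** A supremum in the extended reals could be [-oo]; exhibiting one admissible pair of points rules
    this out. *)
Let seminorm_ge0 (u : R * R -> R) : (0 <= holder_seminorm T alpha u)%E.
Proof.
have p01 : (0, 0) <> (1, 0) :> R * R by move=> [/esym/eqP]; rewrite oner_eq0.
apply: le_trans (seminorm_ge u (strip0 0) (strip0 1) p01).
by rewrite lee_fin divr_ge0.
Qed.

Lemma holder_norm_sup_le (u : R * R -> R) p :
  (holder_norm T alpha u < M%:E)%E -> strip T p -> `|u p| <= M.
Proof.
move=> uM Tp; rewrite -lee_fin (le_trans (sup_norm_ge u Tp))//.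
by rewrite (le_trans _ (ltW uM))// /holder_norm leeDl.
Qed.

Lemma holder_norm_diff_le (u : R * R -> R) p q :
  (holder_norm T alpha u < M%:E)%E -> strip T p -> strip T q ->
  `|u p - u q| <=
    M * (`|p.1 - q.1| `^ alpha + `|p.2 - q.2| `^ (alpha / 2)).
Proof.
move=> uM Tp Tq.
have M0 : 0 <= M by rewrite (le_trans _ (holder_norm_sup_le uM Tp)).
have [->|/eqP pq] := eqVneq p q; first by rewrite subrr normr0 mulr_ge0// den_ge0.
rewrite -ler_pdivrMr; last exact: den_gt0.
rewrite -lee_fin (le_trans (seminorm_ge u Tp Tq pq))//.
by rewrite (le_trans _ (ltW uM))// /holder_norm leeDr.
Qed.

Lemma measurable_strip : measurable (strip T).
Proof.
rewrite (_ : strip T = setT `*` `[0, T]%classic).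
  by apply: measurableX => //; exact: measurable_itv.
by apply/seteqP; split=> [p|p []]; rewrite /strip /= in_itv/=.
Qed.

Lemma powR_lt_eps (p e : R) : 0 < p -> 0 < e ->
  exists2 d, 0 < d & forall u, 0 <= u -> u < d -> u `^ p < e.
Proof.
move=> p0 e0; exists (e `^ p^-1); first by rewrite powR_gt0.
move=> u u0 ue; rewrite -[ltRHS](@powRr1 _ e) ?ltW//.
rewrite -(mulVf (lt0r_neq0 p0)) powRrM.
by rewrite gt0_ltr_powR// ?nnegrE ?powR_ge0.
Qed.

Lemma measurable_holder (u : R * R -> R) :
  (holder_norm T alpha u < M%:E)%E -> measurable_fun (strip T) u.
Proof.
move=> uM; apply: measurable_fun_plane; first exact: measurable_strip.
move=> p e Tp e0.
have M0 : 0 <= M by rewrite (le_trans _ (holder_norm_sup_le uM Tp)).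
(* [M + 1] guards against division by zero, as only [0 <= M] is known. *)
have e1 : 0 < e / (2 * (M + 1)) by rewrite divr_gt0// mulr_gt0//; lra.
have [d1 d10 d1P] := powR_lt_eps alpha0 e1.
have [d2 d20 d2P] : exists2 d, 0 < d &
    forall u, 0 <= u -> u < d -> u `^ (alpha / 2) < e / (2 * (M + 1)).
  by apply: powR_lt_eps; [rewrite divr_gt0|].
exists (Num.min d1 d2); first by rewrite lt_min d10.
move=> q Tq; rewrite !lt_min => /andP[q1 _] /andP[_ q2].
apply: le_lt_trans (holder_norm_diff_le uM Tq Tp) _.
have := d1P _ (normr_ge0 _) q1; have := d2P _ (normr_ge0 _) q2 => h2 h1.
apply: (@le_lt_trans _ _ (M * (e / (M + 1)))).
  rewrite ler_wpM2l//; apply: le_trans (lerD (ltW h1) (ltW h2)) _.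
  by rewrite le_eqVlt; apply/orP; left; apply/eqP; field; rewrite gt_eqF//; lra.
by rewrite mulrCA gtr_pMr// ltr_pdivrMr ?mul1r; [lra|lra].
Qed.

End holder_facts.

Section Zker_derivatives.
Context {R : realType}.
Implicit Types (v : coeffs R) (c w x t xi tau z : R).

(** [w^-1] is a mere constant factor of the exponent, so the formula also covers [w = 0], where the
    inverse is 0. *)
Lemma is_derive_gaussian c w xi z :
  is_derive z 1 (fun z : R => c * expR (- ((z - xi) ^+ 2 / w)))
    (- (2 * (z - xi) / w) * (c * expR (- ((z - xi) ^+ 2 / w)))).
Proof.
have dg : is_derive z 1 (fun z : R => - ((z - xi) ^+ 2 / w)) (- (2 * (z - xi) / w)).
  apply: is_derive_eq.
  by rewrite /GRing.scale/=; ring.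
have := @is_derive1_comp _ expR (fun z : R => - ((z - xi) ^+ 2 / w)) z _ _
  (is_derive_expR _) dg.
move=> de; apply: is_derive_eq; rewrite /GRing.scale/=; ring.
Qed.

Lemma derive1_Zker v x t xi tau :
  derive1 (fun z : R => Zker v z t xi tau) x =
  - (2 * (x - xi) / (4 * coef_a v (xi, tau) * (t - tau))) * Zker v x t xi tau.
Proof.
by rewrite derive1E; have [_ ->] := is_derive_gaussian
  (Num.sqrt (4 * pi * coef_a v (xi, tau) * (t - tau)))^-1
  (4 * coef_a v (xi, tau) * (t - tau)) xi x.
Qed.

Lemma derive1n2_Zker v x t xi tau :
  derive1n 2 (fun z : R => Zker v z t xi tau) x =
  ((2 * (x - xi) / (4 * coef_a v (xi, tau) * (t - tau))) ^+ 2 -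
    2 / (4 * coef_a v (xi, tau) * (t - tau))) * Zker v x t xi tau.
Proof.
rewrite -[LHS]/(derive1 (derive1 (fun z : R => Zker v z t xi tau)) x).
have -> : derive1 (fun z : R => Zker v z t xi tau) = (fun z : R =>
    - (2 * (z - xi) / (4 * coef_a v (xi, tau) * (t - tau))) * Zker v z t xi tau).
  by apply/funext => z; exact: derive1_Zker.
rewrite /Zker; set w := 4 * _ * (t - tau); set c := (Num.sqrt _)^-1.
rewrite derive1E; have dg := is_derive_gaussian c w xi x.
have dl : is_derive x 1 (fun z : R => - (2 * (z - xi) / w)) (- (2 / w)).
  by apply: is_derive_eq; rewrite /GRing.scale/=; ring.
have dm : is_derive x 1 (fun z : R =>
  - (2 * (z - xi) / w) * (c * expR (- ((z - xi) ^+ 2 / w)))) _ := is_deriveM dl dg.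
have [_ ->] := dm.
by rewrite /GRing.scale/=; ring.
Qed.

(** With the derivatives eliminated, [LZ1] is an algebraic expression in the coefficients and
    [Zker], from which bounds, measurability and limits in [n] can be read off. *)
Lemma LZ1E v x t xi tau : LZ1 v x t xi tau =
  let q := 2 * (x - xi) / (4 * coef_a v (xi, tau) * (t - tau)) in
  ((coef_a v (xi, tau) - coef_a v (x, t)) *
     (q ^+ 2 - 2 / (4 * coef_a v (xi, tau) * (t - tau))) -
   coef_b v (x, t) * q + coef_c v (x, t)) * Zker v x t xi tau.
Proof. by rewrite /LZ1 derive1n2_Zker derive1_Zker; ring. Qed.

End Zker_derivatives.

(** Combines [(1+z)^3 <= 8 (1+z^4)] with [exp y >= 1 + y^2/2] at [y = z^2/(8M)], where
    [y^2/2 = z^4/(128 M^2)]. *)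
Lemma cube_expRN_le (R : realType) (M z : R) : 0 < M -> 0 <= z ->
  (1 + z) ^+ 3 * expR (- (z ^+ 2 / (8 * M))) <= 8 * (1 + 128 * M ^+ 2).
Proof.
move=> M0 z0; rewrite expRN ler_pdivrMr ?expR_gt0//.
have M20 : 0 < M ^+ 2 by rewrite exprn_gt0.
have z4 : (1 + z) ^+ 3 <= 8 * (1 + z ^+ 4).
  have [z1|/ltW z1] := leP z 1.
    have : (1 + z) ^+ 3 <= 2 ^+ 3 by rewrite lerXn2r ?nnegrE//; lra.
    by have := exprn_ge0 4 z0; lra.
  have h1 : (1 + z) ^+ 3 <= (2 * z) ^+ 3 by rewrite lerXn2r ?nnegrE//; lra.
  have h2 : z ^+ 3 <= z ^+ 4 by rewrite ler_weXn2l.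
  by move: h1; rewrite exprMn; lra.
apply: (le_trans z4).
have y0 : 0 <= z ^+ 2 / (8 * M) by rewrite divr_ge0 ?sqr_ge0// mulr_ge0// ltW.
have := expR_ge1Dxn 1 y0.
rewrite (_ : 2`!%:R = 2)// => he.
apply: le_trans (ler_wpM2l _ he); last first.
  by rewrite mulr_ge0// addr_ge0// mulr_ge0// ltW.
rewrite -subr_ge0 [leRHS](_ : _ = 8 * (128 * M ^+ 2 + z ^+ 4 / (128 * M ^+ 2))).
  by rewrite mulr_ge0// addr_ge0 ?divr_ge0 ?mulr_ge0 ?exprn_ge0// ltW.
by field; rewrite gt_eqF.
Qed.

Lemma measurable_funV d (X : measurableType d) (R : realType) (D : set X)
    (f : X -> R) :
  measurable_fun D f -> (forall x, D x -> 0 <= f x) ->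
  measurable_fun D (fun x => (f x)^-1).
Proof.
move=> mf f0; apply: (eq_measurable_fun (fun x => f x `^ (-1))).
  by move=> x; rewrite inE => Dx; rewrite powR_inv1// f0.
apply: (@measurableT_comp _ _ _ _ _ _ (fun u : R => u `^ (-1))) => //.
Qed.

Lemma measurable_fun_sqrt d (X : measurableType d) (R : realType) (D : set X)
    (f : X -> R) :
  measurable_fun D f -> (forall x, D x -> 0 <= f x) ->
  measurable_fun D (fun x => Num.sqrt (f x)).
Proof.
move=> mf f0; apply: (eq_measurable_fun (fun x => f x `^ (2^-1))).
  by move=> x; rewrite inE => Dx; rewrite powR12_sqrt// f0.
apply: (@measurableT_comp _ _ _ _ _ _ (fun u : R => u `^ (2^-1))) => //.
Qed.

(** * Gaussian bounds uniform over the ball of coefficients *)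

Section coefficient_kernels.
Context {R : realType} (T alpha lambda M : R).
Hypotheses (T0 : 0 < T) (alpha0 : 0 < alpha) (alpha1 : alpha <= 1).
Hypotheses (lambda0 : 0 < lambda) (lambdaM : lambda < M).
Implicit Types (v : coeffs R) (x t xi tau : R).

Let M0 : 0 < M. Proof. exact: lt_trans lambdaM. Qed.

Let past_strip t tau : 0 <= tau -> tau < t -> t <= T ->
  (forall x, strip T (x, t)) /\ (forall xi, strip T (xi, tau)).
Proof.
move=> tau0 taut tT; split=> y; rewrite /strip/=.
  by rewrite tT (le_trans tau0)// ltW.
by rewrite tau0 (le_trans (ltW taut)).
Qed.

Let coef_a_bounds v p : coeff_ball T M lambda alpha v -> strip T p ->
  lambda <= coef_a v p <= M.
Proof.
move=> [_ [al [aM _ _]]] Tp; rewrite al//= (le_trans (ler_norm _))//.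
exact: holder_norm_sup_le aM Tp.
Qed.

Let Zker_ge0 v x t xi tau : 0 <= Zker v x t xi tau.
Proof. by rewrite mulr_ge0 ?expR_ge0// invr_ge0 sqrtr_ge0. Qed.

(** Since [lambda <= a <= M], the prefactor is largest at [lambda] and the exponential at [M]. The
    Gaussian of width [4 M] is split into two of width [8 M]: one stays in the bound, the other is
    reserved for polynomial factors. *)
Let Zker_le v x t xi tau : coeff_ball T M lambda alpha v ->
  0 <= tau -> tau < t -> t <= T ->
  Zker v x t xi tau <= (Num.sqrt (4 * pi * lambda))^-1 *
    (gauss_kernel (8 * M) (x - xi) (t - tau) *
     expR (- ((x - xi) ^+ 2 / (8 * M * (t - tau))))).
Proof.
move=> vB tau0 taut tT; have [_ st] := past_strip tau0 taut tT.
have /andP[al aM] := coef_a_bounds vB (st xi).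
have s0 : 0 < t - tau by rewrite subr_gt0.
rewrite /Zker /gauss_kernel; set a := coef_a v _ in al aM *; set s := t - tau in s0 *.
have a0 : 0 < a by exact: lt_le_trans al.
have s0' := ltW s0; have lambda0' := ltW lambda0.
set Y := expR (- ((x - xi) ^+ 2 / (8 * M * s))).
rewrite [leRHS](_ : _ =
  (Num.sqrt (4 * pi * lambda))^-1 * (Num.sqrt s)^-1 * (Y * Y)); last by ring.
rewrite /Y -expRD ler_pM ?expR_ge0 ?invr_ge0 ?sqrtr_ge0//.
- rewrite -invfM -sqrtrM ?mulr_ge0 ?pi_ge0//.
  rewrite lef_pV2 ?posrE ?sqrtr_gt0 ?mulr_gt0 ?pi_gt0// ler_wsqrtr//.
  by rewrite ler_wpM2r// ler_wpM2l// mulr_ge0 ?pi_ge0.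
- rewrite ler_expR -opprD lerN2 -mulrDr [_^-1 + _^-1](_ : _ = (4 * M * s)^-1).
    by rewrite ler_wpM2l ?sqr_ge0// lef_pV2 ?posrE ?mulr_gt0// ler_wpM2r// ler_wpM2l.
  by field; rewrite !gt_eqF.
Qed.

Let alpha2 : 0 < alpha / 2 <= 1.
Proof. have h := alpha1; by apply/andP; split; [rewrite divr_gt0|lra]. Qed.

(** Brings every milder power of time to the single singular power [alpha/2 - 1], at the cost of a
    power of [T]. *)
Let powR_time_le p s : 0 < s -> s <= T -> alpha / 2 - 1 <= p ->
  s `^ p <= T `^ (p + 1 - alpha / 2) * s `^ (alpha / 2 - 1).
Proof.
move=> s0 sT hp; rewrite [in leLHS](_ : p = (p + 1 - alpha / 2) + (alpha / 2 - 1)); last by ring.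
rewrite powRD; last by rewrite (gt_eqF s0) implybT.
by rewrite ler_wpM2r ?powR_ge0// ge0_ler_powR ?nnegrE//; lra.
Qed.

Lemma kernel_bound_Zker : exists2 B, 0 <= B & forall v,
  coeff_ball T M lambda alpha v ->
  kernel_bound T (8 * M) (alpha / 2) 0 B (Zker v).
Proof.
exists ((Num.sqrt (4 * pi * lambda))^-1 * T `^ (1 - alpha / 2)).
  by rewrite mulr_ge0 ?powR_ge0// invr_ge0 sqrtr_ge0.
move=> v vB x t xi tau tau0 taut tT.
rewrite ger0_norm// (le_trans (Zker_le x xi vB tau0 taut tT))//.
rewrite mul0r expR0 mulr1; set G := gauss_kernel _ _ _.
rewrite -[leRHS]mulrA -[leRHS]mulrA ler_wpM2l ?invr_ge0 ?sqrtr_ge0//.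
rewrite [leRHS]mulrA [leRHS]mulrC ler_wpM2l ?gauss_kernel_ge0//.
have s0 : 0 < t - tau by rewrite subr_gt0.
rewrite (@le_trans _ _ 1)//.
  rewrite -expR0 ler_expR oppr_le0 divr_ge0 ?sqr_ge0//.
  by rewrite !mulr_ge0// ltW.
have := @powR_time_le 0 (t - tau) s0; rewrite powRr0 add0r; apply; first lra.
by case/andP: alpha2 => _ ?; lra.
Qed.

(** [z] is the distance in parabolic units. The three terms of [LZ1] have time orders [alpha/2 - 1],
    [-1/2] and [0]; [alpha <= 1] makes the first the worst, and the powers of [T] adjust the other
    two. *)
Let LZ1_le v x t xi tau (z := `|x - xi| / Num.sqrt (t - tau)) :
  coeff_ball T M lambda alpha v -> 0 <= tau -> tau < t -> t <= T ->
  `|LZ1 v x t xi tau| <= M * (t - tau) `^ (alpha / 2 - 1) *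
   (2 * ((2 * lambda)^-1 ^+ 2 + (2 * lambda)^-1) +
    (2 * lambda)^-1 * T `^ (1 / 2 - alpha / 2) + T `^ (1 - alpha / 2)) *
   (1 + z) ^+ 3 * Zker v x t xi tau.
Proof.
move=> vB tau0 taut tT; have [st st'] := past_strip tau0 taut tT.
have /andP[al _] := coef_a_bounds vB (st' xi).
have [_ [_ [aM bM cM]]] := vB; have alpha1' := alpha1.
have dA := holder_norm_diff_le T0 aM (st' xi) (st x).
have dB := holder_norm_sup_le T0 bM (st x).
have dC := holder_norm_sup_le T0 cM (st x).
rewrite LZ1E/= normrM (ger0_norm (Zker_ge0 _ _ _ _ _)) ler_wpM2r//.
set s := t - tau in z *; have s0 : 0 < s by rewrite subr_gt0.
set r := Num.sqrt s in z *; have r0 : 0 < r by rewrite sqrtr_gt0.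
have r2 : r ^+ 2 = s by rewrite sqr_sqrtr// ltW.
have sT : s <= T by rewrite /s; lra.
have z0 : 0 <= z by rewrite divr_ge0// ltW.
set a := coef_a v (xi, tau) in al dA *; have a0 : 0 < a by exact: lt_le_trans al.
set l := (2 * lambda)^-1; have l0 : 0 < l by rewrite invr_gt0 mulr_gt0.
have al' : (2 * a)^-1 <= l by rewrite lef_pV2 ?posrE ?mulr_gt0// ler_wpM2l.
have zr : `|x - xi| = z * r by rewrite /z divfK// gt_eqF.
set q := 2 * (x - xi) / (4 * a * s).
have qle : `|q| <= l * z * r^-1.
  have -> : `|q| = (2 * a)^-1 * z * r^-1.
    rewrite /q -r2 normrM normrM zr (ger0_norm (ler0n _ _)) ger0_norm; last first.
      by rewrite invr_ge0 mulr_ge0 ?sqr_ge0// mulr_ge0// ltW.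
    by field; rewrite !gt_eqF.
  by rewrite ler_wpM2r ?invr_ge0 ?(ltW r0)// ler_wpM2r.
have q2le : q ^+ 2 <= l ^+ 2 * z ^+ 2 * s^-1.
  rewrite -(real_normK (num_real q)) (le_trans (lerXn2r 2 _ _ qle)) ?nnegrE//.
    exact: le_trans (normr_ge0 q) qle.
  by rewrite !exprMn (exprVn r) r2.
set w := 2 / (4 * a * s).
have wle : `|w| <= l * s^-1.
  rewrite ger0_norm ?divr_ge0 ?mulr_ge0 ?(ltW a0) ?(ltW s0)//.
  rewrite /w (_ : _ / _ = (2 * a)^-1 * s^-1); last by field; rewrite !gt_eqF.
  by rewrite ler_wpM2r// invr_ge0 ltW.
set sb := s `^ (alpha / 2 - 1).
have sb0 : 0 <= sb by exact: powR_ge0.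
have rle : r^-1 <= T `^ (1 / 2 - alpha / 2) * sb.
  have -> : r^-1 = s `^ (- (1 / 2)).
    by rewrite powRN mul1r powR12_sqrt// ltW.
  apply: le_trans (powR_time_le s0 sT _) _; first lra.
  by rewrite (_ : - (1 / 2) + 1 - alpha / 2 = 1 / 2 - alpha / 2)//; lra.
have onele : 1 <= T `^ (1 - alpha / 2) * sb.
  have := @powR_time_le 0 s s0 sT; rewrite powRr0 add0r; apply.
  by case/andP: alpha2 => _ ?; lra.
have zale : z `^ alpha <= 1 + z.
  have [z1|/ltW z1] := leP z 1.
    rewrite (@le_trans _ _ (1 `^ alpha))//; last by rewrite powR1 lerDl.
    by rewrite ge0_ler_powR ?nnegrE// ltW.
  by rewrite (le_trans (ler1_powR z1 alpha1))// lerDr.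
(* Here [|x-xi|^alpha] equals [z^alpha s^(alpha/2)]; with [z^alpha <= 1 + z], the space and time
   increments together give [2 + z]. *)
have dA' : `|a - coef_a v (x, t)| <= M * (2 + z) * s `^ (alpha / 2).
  apply: (le_trans dA); rewrite /= -mulrA ler_wpM2l ?(ltW M0)//.
  rewrite distrC zr distrC (gtr0_norm s0) powRM ?(ltW r0)//.
  have -> : r `^ alpha = s `^ (alpha / 2).
    by rewrite /r -powR12_sqrt ?(ltW s0)// -powRrM mulrC.
  rewrite -[X in _ + X]mul1r -mulrDl ler_wpM2r ?powR_ge0//; lra.
have sbE : s `^ (alpha / 2) * s^-1 = sb.
  rewrite /sb powRD; last by rewrite (gt_eqF s0) implybT.
  by rewrite powR_inv1// ltW.
set T1 := T `^ _ in rle *; set T2 := T `^ _ in onele *.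
have T10 : 0 <= T1 by exact: powR_ge0.
have T20 : 0 <= T2 by exact: powR_ge0.
have M0' := ltW M0; have l0' := ltW l0.
have b1 : `|a - coef_a v (x, t)| * (`|q ^+ 2| + `|w|) <=
    M * sb * ((2 + z) * (l ^+ 2 * z ^+ 2 + l)).
  rewrite [leRHS](_ : _ = (M * (2 + z) * s `^ (alpha / 2)) *
     (l ^+ 2 * z ^+ 2 * s^-1 + l * s^-1)); last by rewrite -sbE; ring.
  by rewrite ler_pM ?addr_ge0// lerD// ger0_norm ?sqr_ge0.
have b2 : `|coef_b v (x, t)| * `|q| <= M * sb * (l * z * T1).
  rewrite [leRHS](_ : _ = M * (l * z * (T1 * sb))); last by ring.
  by rewrite ler_pM// (le_trans qle)// ler_wpM2l// mulr_ge0.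
have b3 : `|coef_c v (x, t)| <= M * sb * T2.
  by rewrite (le_trans dC)// -mulrA ler_peMr// mulrC.
apply: (@le_trans _ _ (M * sb * ((2 + z) * (l ^+ 2 * z ^+ 2 + l)) +
   M * sb * (l * z * T1) + M * sb * T2)).
  apply: le_trans (ler_normD _ _) (lerD _ b3).
  apply: le_trans (ler_normB _ _) (lerD _ _); last by rewrite normrM.
  by rewrite normrM (le_trans _ b1)// ler_wpM2l// ler_normB.
rewrite -!mulrDr -(mulrA (M * sb)) ler_wpM2l ?mulr_ge0//.
(* Degree three in [z]: one from the Hoelder increment, two from the second derivative. *)
have h1 : (2 + z) * (l ^+ 2 * z ^+ 2 + l) <= 2 * (l ^+ 2 + l) * (1 + z) ^+ 3.
  rewrite [leRHS](_ : _ = (2 * (1 + z)) * ((l ^+ 2 + l) * (1 + z) ^+ 2)); last by ring.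
  apply: ler_pM; [lra| |lra|].
    by rewrite addr_ge0// mulr_ge0 ?sqr_ge0.
  rewrite mulrDl lerD//.
    by rewrite ler_wpM2l ?sqr_ge0// lerXn2r ?nnegrE//; lra.
  by rewrite ler_peMr// exprn_ege1// lerDl.
have z31 : 1 <= (1 + z) ^+ 3 by rewrite exprn_ege1// lerDl.
have z3z : z <= (1 + z) ^+ 3.
  by rewrite (@le_trans _ _ (1 + z)) ?lerDr// ler_eXnr// lerDl.
have h2 : l * z * T1 <= l * T1 * (1 + z) ^+ 3.
  by rewrite mulrAC ler_wpM2l// mulr_ge0.
have h3 : T2 <= T2 * (1 + z) ^+ 3 by rewrite ler_peMr.
by apply: le_trans (lerD (lerD h1 h2) h3) _; rewrite -!mulrDl.
Qed.

Lemma kernel_bound_LZ1 : exists2 B, 0 <= B & forall v,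
  coeff_ball T M lambda alpha v ->
  kernel_bound T (8 * M) (alpha / 2) 0 B (LZ1 v).
Proof.
pose C := 2 * ((2 * lambda)^-1 ^+ 2 + (2 * lambda)^-1) +
  (2 * lambda)^-1 * T `^ (1 / 2 - alpha / 2) + T `^ (1 - alpha / 2).
have C0 : 0 <= C.
  have ? := ltW lambda0.
  by rewrite !addr_ge0 ?mulr_ge0 ?addr_ge0 ?powR_ge0 ?sqr_ge0 ?invr_ge0 ?mulr_ge0.
pose c := (Num.sqrt (4 * pi * lambda))^-1.
have c0 : 0 <= c by rewrite invr_ge0 sqrtr_ge0.
have M0' := ltW M0.
exists (M * C * c * (8 * (1 + 128 * M ^+ 2))).
  by rewrite !mulr_ge0// addr_ge0// mulr_ge0// sqr_ge0.
move=> v vB x t xi tau tau0 taut tT.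
apply: le_trans (LZ1_le x xi vB tau0 taut tT) _.
rewrite -/C; set sb := _ `^ (alpha / 2 - 1).
have s0 : 0 < t - tau by rewrite subr_gt0.
set z := `|x - xi| / _.
have z0 : 0 <= z by rewrite divr_ge0// sqrtr_ge0.
have zE : (x - xi) ^+ 2 / (8 * M * (t - tau)) = z ^+ 2 / (8 * M).
  rewrite /z expr_div_n sqr_sqrtr ?(ltW s0)// real_normK ?num_real//.
  by field; rewrite !gt_eqF.
have := Zker_le x xi vB tau0 taut tT; rewrite zE -/c.
set G := gauss_kernel _ _ _; have G0 : 0 <= G by exact: gauss_kernel_ge0.
set Y := expR _ => Zle.
apply: (@le_trans _ _ (M * sb * C * (1 + z) ^+ 3 * (c * (G * Y)))).
  by rewrite ler_wpM2l// !mulr_ge0 ?powR_ge0 ?exprn_ge0// addr_ge0.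
rewrite mul0r expR0 mulr1.
rewrite [leLHS](_ : _ = M * sb * C * c * G * ((1 + z) ^+ 3 * Y)); last by ring.
rewrite [leRHS](_ : _ = M * sb * C * c * G * (8 * (1 + 128 * M ^+ 2))); last by ring.
by rewrite ler_wpM2l ?cube_expRN_le// !mulr_ge0 ?powR_ge0.
Qed.

End coefficient_kernels.

Section coefficient_kernel_measurability.
Context {R : realType} (T alpha lambda M : R) (v : coeffs R).
Hypotheses (T0 : 0 < T) (alpha0 : 0 < alpha) (lambda0 : 0 < lambda).
Hypothesis vB : coeff_ball T M lambda alpha v.

Local Notation fp := ((R * R) * (R * R))%type.

Let m11 : measurable_fun (past T) (fun z : fp => z.1.1).
Proof. by apply: measurable_funTS; exact: (measurableT_comp measurable_fst measurable_fst). Qed.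

Let m12 : measurable_fun (past T) (fun z : fp => z.1.2).
Proof. by apply: measurable_funTS; exact: (measurableT_comp measurable_snd measurable_fst). Qed.

Let m21 : measurable_fun (past T) (fun z : fp => z.2.1).
Proof. by apply: measurable_funTS; exact: (measurableT_comp measurable_fst measurable_snd). Qed.

Let m22 : measurable_fun (past T) (fun z : fp => z.2.2).
Proof. by apply: measurable_funTS; exact: (measurableT_comp measurable_snd measurable_snd). Qed.

Let past_fst z : past T z -> strip T z.1.
Proof.
rewrite /past/strip/= => /and3P[tau0 taut ->].
by rewrite andbT (le_trans tau0)// ltW.
Qed.

Let past_snd z : past T z -> strip T z.2.
Proof.
by rewrite /past/strip/= => /and3P[-> taut tT]; rewrite (le_trans (ltW taut)).
Qed.

Let measurable_coef_fst (u : R * R -> R) : (holder_norm T alpha u < M%:E)%E ->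
  measurable_fun (past T) (fun z : fp => u (z.1.1, z.1.2)).
Proof.
move=> uM; apply: (eq_measurable_fun (u \o fst)) => [[[? ?] ?]//|].
apply: (measurable_comp (measurable_strip T) _ (measurable_holder T0 alpha0 uM)).
  by move=> _ [z /past_fst zT <-].
by apply: measurable_funTS; exact: measurable_fst.
Qed.

Let measurable_coef_snd (u : R * R -> R) : (holder_norm T alpha u < M%:E)%E ->
  measurable_fun (past T) (fun z : fp => u (z.2.1, z.2.2)).
Proof.
move=> uM; apply: (eq_measurable_fun (u \o snd)) => [[? [? ?]]//|].
apply: (measurable_comp (measurable_strip T) _ (measurable_holder T0 alpha0 uM)).
  by move=> _ [z /past_snd zT <-].
by apply: measurable_funTS; exact: measurable_snd.
Qed.

Let coef_gt0 p : strip T p -> 0 < coef_a v p.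
Proof.
by move=> Tp; case: vB => _ [al _]; rewrite (lt_le_trans lambda0)// al.
Qed.

(** [width 4] is the denominator in the exponent of [Zker], and [width (4 * pi)] the quantity under
    its square root. *)
Let width (c : R) (z : fp) := c * coef_a v (z.2.1, z.2.2) * (z.1.2 - z.2.2).

Let width_ge0 c z : 0 <= c -> past T z -> 0 <= width c z.
Proof.
move=> c0 zT; have /coef_gt0 a0 := past_snd zT.
move: zT => /and3P[_ zt _]; rewrite !mulr_ge0 ?subr_ge0 ?(ltW zt)//.
by move: a0; case: z.2 {zt} => ? ? /ltW.
Qed.

Let measurable_width c : measurable_fun (past T) (width c).
Proof.
case: vB => _ [_ [aM _ _]].
apply: measurable_funM; last exact: measurable_funB.
by apply: measurable_funM => //; exact: measurable_coef_snd.
Qed.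

Let measurable_widthV c : 0 <= c -> measurable_fun (past T) (fun z => (width c z)^-1).
Proof. by move=> c0; apply: measurable_funV => // z; exact: width_ge0. Qed.

Lemma spacetime_measurable_Zker : spacetime_measurable T (Zker v).
Proof.
have pi40 : 0 <= 4 * pi :> R by rewrite mulr_ge0 ?pi_ge0.
apply: measurable_funM.
  apply: measurable_funV; last by move=> z _; rewrite sqrtr_ge0.
  apply: (measurable_fun_sqrt (f := width (4 * pi))) => // z; exact: width_ge0.
apply: (@measurableT_comp _ _ _ _ _ _ expR); first exact: measurable_expR.
apply: (@measurable_funN _ _ _ _ (fun z : fp => (z.1.1 - z.2.1) ^+ 2 * (width 4 z)^-1)).
apply: measurable_funM; last exact: measurable_widthV.
by apply: measurable_funX; exact: measurable_funB.
Qed.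

Lemma spacetime_measurable_LZ1 : spacetime_measurable T (LZ1 v).
Proof.
case: vB => _ [_ [aM bM cM]].
apply: (eq_measurable_fun (fun z : fp =>
  let q := 2 * (z.1.1 - z.2.1) * (width 4 z)^-1 in
  ((coef_a v (z.2.1, z.2.2) - coef_a v (z.1.1, z.1.2)) *
     (q ^+ 2 - 2 * (width 4 z)^-1) -
   coef_b v (z.1.1, z.1.2) * q + coef_c v (z.1.1, z.1.2)) *
  Zker v z.1.1 z.1.2 z.2.1 z.2.2)).
  by move=> z _; rewrite LZ1E.
have mq : measurable_fun (past T)
    (fun z : fp => 2 * (z.1.1 - z.2.1) * (width 4 z)^-1).
  apply: measurable_funM; last exact: measurable_widthV.
  by apply: measurable_funM => //; exact: measurable_funB.
apply: measurable_funM; last exact: spacetime_measurable_Zker.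
apply: measurable_funD; last exact: measurable_coef_fst.
apply: measurable_funB.
  apply: measurable_funM.
    by apply: measurable_funB; [exact: measurable_coef_snd|exact: measurable_coef_fst].
  apply: measurable_funB; first exact: measurable_funX.
  by apply: measurable_funM => //; exact: measurable_widthV.
by apply: measurable_funM => //; exact: measurable_coef_fst.
Qed.

End coefficient_kernel_measurability.

Section coefficient_kernel_cvg.
Context {R : realType} (vn : nat -> coeffs R) (v : coeffs R) (x t xi tau : R).
Hypotheses (taut : tau < t) (a_gt0 : 0 < coef_a v (xi, tau)).
Hypothesis a_cvg :
  coef_a (vn n) (xi, tau) @[n --> \oo] --> coef_a v (xi, tau).

Let width_cvg (c : R) : c * coef_a (vn n) (xi, tau) * (t - tau) @[n --> \oo] -->
  c * coef_a v (xi, tau) * (t - tau).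
Proof. by apply: cvgMl; apply: cvgMr. Qed.

Let widthV_cvg (c : R) : 0 < c ->
  (c * coef_a (vn n) (xi, tau) * (t - tau))^-1 @[n --> \oo] -->
  (c * coef_a v (xi, tau) * (t - tau))^-1.
Proof.
move=> c0; apply: cvgV; last exact: width_cvg.
by rewrite gt_eqF// !mulr_gt0// subr_gt0.
Qed.

Lemma Zker_cvg : Zker (vn n) x t xi tau @[n --> \oo] --> Zker v x t xi tau.
Proof.
have pi40 : 0 < 4 * pi :> R by rewrite mulr_gt0 ?pi_gt0.
apply: cvgM.
  apply: cvgV; first by rewrite gt_eqF// sqrtr_gt0 !mulr_gt0 ?pi_gt0 ?subr_gt0.
  have cs := @sqrt_continuous R (4 * pi * coef_a v (xi, tau) * (t - tau)).
  apply: (@cvg_comp _ _ _ (fun n => 4 * pi * coef_a (vn n) (xi, tau) * (t - tau)) Num.sqrt); last exact: cs.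
  exact: width_cvg.
apply: (cvg_comp _ expR _ (@continuous_expR R _)).
by apply: cvgN; apply: cvgMr; exact: widthV_cvg.
Qed.

Lemma LZ1_cvg :
  coef_a (vn n) (x, t) @[n --> \oo] --> coef_a v (x, t) ->
  coef_b (vn n) (x, t) @[n --> \oo] --> coef_b v (x, t) ->
  coef_c (vn n) (x, t) @[n --> \oo] --> coef_c v (x, t) ->
  LZ1 (vn n) x t xi tau @[n --> \oo] --> LZ1 v x t xi tau.
Proof.
move=> ca cb cc; rewrite LZ1E; under eq_fun do rewrite LZ1E /=.
have cw := @widthV_cvg 4 ltac:(by []).
have cq : 2 * (x - xi) / (4 * coef_a (vn n) (xi, tau) * (t - tau)) @[n --> \oo] -->
   2 * (x - xi) / (4 * coef_a v (xi, tau) * (t - tau)) by apply: cvgMr.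
apply: cvgM; last exact: Zker_cvg.
apply: cvgD; last by [].
apply: cvgB; last by apply: cvgM.
apply: cvgM; first exact: cvgB.
apply: cvgB; last by apply: cvgMr.
by rewrite expr2; under eq_fun do rewrite expr2; apply: cvgM.
Qed.

End coefficient_kernel_cvg.

(** * The Neumann series *)

Section geometrically_bounded_series.
Context {R : realType} (A : R).
Implicit Types u : nat -> R.

Let geo m := A / 2 ^+ m.

(** Telescoping: [geo m = 2 geo m - 2 geo (m+1)]. *)
Lemma geo_bounded_series_diff u : (forall m, `|u m| <= geo m) ->
  forall N d, `|series u (N + d)%N - series u N| <= 2 * geo N - 2 * geo (N + d)%N.
Proof.
move=> uA N; elim=> [|d IH]; first by rewrite addn0 !subrr normr0.
rewrite addnS [series u _.+1]seriesS -addrA.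
have -> : 2 * geo N - 2 * geo (N + d).+1 =
    (2 * geo N - 2 * geo (N + d)%N) + geo (N + d)%N.
  by rewrite /geo exprS invfM; field; rewrite !expf_neq0 ?pnatr_eq0.
by apply: le_trans (ler_normD _ _) _; rewrite [leRHS]addrC lerD.
Qed.

Lemma geo_bounded_series_cvg u : (forall m, `|u m| <= geo m) ->
  cvgn (series u).
Proof.
move=> uA; apply: normed_cvg.
apply: (@series_le_cvg _ _ (geometric A 2^-1)) => [n|n|n|].
- exact: normr_ge0.
- by rewrite /= (le_trans (normr_ge0 (u n)))// (le_trans (uA n))// /geo exprVn.
- by rewrite /= (le_trans (uA n))// /geo exprVn.
- by apply: is_cvg_geometric_series; rewrite ger0_norm ?invr_ge0// invf_lt1// ltr1n.
Qed.

(** At [N = 0] the partial sum is empty and this bounds the sum itself, which is how [phi] gets its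
    constant [2 * B]. *)
Lemma geo_bounded_series_tail u : (forall m, `|u m| <= geo m) ->
  forall N, `|limn (series u) - series u N| <= 2 * geo N.
Proof.
move=> uA N.
have A0 : 0 <= A by rewrite (le_trans (normr_ge0 _) (le_trans (uA 0%N) _))// /geo divr1.
have cS : `|series u n - series u N| @[n --> \oo] --> `|limn (series u) - series u N|.
  apply: cvg_norm; apply: cvgB; last exact: cvg_cst.
  exact: geo_bounded_series_cvg.
apply: (cvgr_to_le cS); near=> n.
have Nn : (N <= n)%N by near: n; exact: nbhs_infty_ge.
have := @geo_bounded_series_diff u uA N (n - N)%N; rewrite subnKC// => /le_trans; apply.
by rewrite lerBlDr lerDl mulr_ge0// /geo divr_ge0// exprn_ge0.
Unshelve. all: by end_near. Qed.

(* Tannery's theorem with a geometric majorant. *)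
Lemma geo_bounded_series_lim_cvg (u_ : nat -> nat -> R) u :
  (forall n m, `|u_ n m| <= geo m) ->
  (forall m, u_ n m @[n --> \oo] --> u m) ->
  limn (series (u_ n)) @[n --> \oo] --> limn (series u).
Proof.
move=> uA cu.
have uA' m : `|u m| <= geo m.
  have cn : `|u_ n m| @[n --> \oo] --> `|u m| by apply: cvg_norm; exact: cu.
  by apply: (cvgr_to_le cn); apply: nearW => n.
have A0 : 0 <= A by rewrite (le_trans (normr_ge0 _) (le_trans (uA' 0%N) _))// /geo divr1.
have cS N : series (u_ n) N @[n --> \oo] --> series u N.
  elim: N => [|N IH].
    by rewrite /series/= big_geq//; under eq_fun do rewrite big_geq//; exact: cvg_cst.
  by rewrite seriesS; under eq_fun do rewrite seriesS; apply: cvgD.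
apply/cvgrPdist_lt => e e0.
(* The common majorant lets one [N] make the tails of all series, limit included, smaller than
   [e / 3]; the partial sums up to [N] account for the last third. *)
have [N hN] : exists N, 2 * geo N < e / 3.
  have cg : 2 * (geometric A 2^-1 n) @[n --> \oo] --> 2 * (0 : R).
    apply: cvgMr; apply: cvg_geometric.
    by rewrite ger0_norm ?invr_ge0// invf_lt1// ltr1n.
  have /cvgrPdist_lt /(_ (e / 3)) := cg; rewrite divr_gt0// => /(_ isT)[N _ /(_ N (leqnn N))].
  rewrite mulr0 sub0r normrN => h; exists N; apply: le_lt_trans h.
  by rewrite /geo /= exprVn ler_norm.
have e3 : 0 < e / 3 by rewrite divr_gt0.
have /cvgrPdist_lt /(_ _ e3) := cS N.
apply: filterS => n hn.
have t1 := geo_bounded_series_tail uA' N.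
have t2 := geo_bounded_series_tail (uA n) N.
rewrite (_ : _ - _ = (limn (series u) - series u N) + (series u N - series (u_ n) N)
   - (limn (series (u_ n)) - series (u_ n) N)); last by ring.
apply: le_lt_trans (ler_normB _ _) _.
apply: le_lt_trans (lerD (ler_normD _ _) (lexx _)) _.
lra.
Qed.

End geometrically_bounded_series.

Section parametrix_iterates.
Context {R : realType} (T alpha lambda M : R).
Hypotheses (T0 : 0 < T) (alpha0 : 0 < alpha) (alpha1 : alpha <= 1).
Hypotheses (lambda0 : 0 < lambda) (lambdaM : lambda < M).
Implicit Types (v : coeffs R) (x t xi tau : R).

Local Notation bound := (kernel_bound T (8 * M) (alpha / 2)).

Let M80 : 0 < 8 * M.
Proof. by rewrite mulr_gt0// (lt_trans lambda0). Qed.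

Let be01 : 0 < alpha / 2 <= 1.
Proof. have h := alpha1; by apply/andP; split; [rewrite divr_gt0|lra]. Qed.

Let strip_snd t tau xi : tau < t -> 0 <= tau -> t <= T -> strip T (xi, tau).
Proof. by move=> taut tau0 tT; rewrite /strip/= tau0 (le_trans (ltW taut)). Qed.

Let strip_fst t tau x : tau < t -> 0 <= tau -> t <= T -> strip T (x, t).
Proof. by move=> taut tau0 tT; rewrite /strip/= tT (le_trans tau0)// ltW. Qed.

Lemma kernel_bound_le mu mu' B B' (K : R -> R -> R -> R -> R) :
  mu <= mu' -> 0 <= B -> B <= B' -> bound mu B K -> bound mu' B' K.
Proof.
move=> mumu' B0 BB' bK x t xi tau tau0 taut tT.
apply: (le_trans (bK _ _ _ _ tau0 taut tT)).
rewrite ler_wpM2r ?gauss_kernel_ge0// ler_wpM2r ?powR_ge0// ler_pM ?expR_ge0//.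
by rewrite ler_expR ler_wpM2r// subr_ge0 ltW.
Qed.

(* A large exponential weight [mu] turns each convolution with [LZ1] into a
   contraction by the factor [1/2]. *)
Lemma LZ_bounds : exists B mu, [/\ 0 <= B, 0 < mu, (forall v,
    coeff_ball T M lambda alpha v -> bound 0 B (LZ1 v)) & forall v,
    coeff_ball T M lambda alpha v -> forall m,
    spacetime_measurable T (LZ v m) /\ bound mu (B / 2 ^+ m) (LZ v m)].
Proof.
have [B B0 bB] := kernel_bound_LZ1 T0 alpha0 alpha1 lambda0 lambdaM.
pose C := stconv_const T (8 * M) (alpha / 2).
have C0 : 0 <= C.
  by rewrite !mulr_ge0 ?sqrtr_ge0 ?powR_ge0 ?invr_ge0 ?divr_ge0// ltW.
have D0 : 0 < 2 * (B * C + 1) by rewrite mulr_gt0// ltr_wpDl// mulr_ge0.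
(* The exponent is chosen so that [mu^(-alpha/4)] is the inverse of [2 (B C + 1)]; adding 1 keeps
   [mu] positive when [B C = 0]. *)
pose mu := (2 * (B * C + 1)) `^ (2 / (alpha / 2)).
have mu0 : 0 < mu by rewrite powR_gt0.
have muE : B * C * mu `^ (- (alpha / 2 / 2)) <= 2^-1.
  rewrite /mu -powRrM [X in _ `^ X](_ : _ = -1); last first.
    by field; rewrite gt_eqF.
  rewrite powR_inv1 ?(ltW D0)// ler_pdivrMr//; lra.
exists B, mu; split=> // v vB; elim=> [|m [mL bL]].
  split; first exact: spacetime_measurable_LZ1 vB.
  by apply: (kernel_bound_le (ltW mu0) B0 _ (bB _ vB)); rewrite expr0 divr1.
have mL1 := spacetime_measurable_LZ1 T0 alpha0 lambda0 vB.
have B20 : 0 <= B / 2 ^+ m by rewrite divr_ge0// exprn_ge0.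
split; first exact: measurable_stconv.
have := kernel_bound_stconv M80 be01 mu0 mL1 mL B0 B20 (bB _ vB) bL.
apply: kernel_bound_le => //.
  by do 3!rewrite mulr_ge0 ?powR_ge0//.
rewrite exprS invfM (_ : _ * _ * _ * _ =
  B / 2 ^+ m * (B * C * mu `^ (- (alpha / 2 / 2)))); last by rewrite /C; ring.
by rewrite [leRHS](_ : _ = B / 2 ^+ m * 2^-1) ?ler_wpM2l//; ring.
Qed.

Section phi_facts.
Variables (B mu : R).
Implicit Type u : coeffs R.

Let good u := forall m,
  spacetime_measurable T (LZ u m) /\ bound mu (B / 2 ^+ m) (LZ u m).

Let weight x t xi tau := B * expR (mu * (t - tau)) *
  (t - tau) `^ (alpha / 2 - 1) * gauss_kernel (8 * M) (x - xi) (t - tau).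

Let term_le u m x t xi tau : good u -> 0 <= tau -> tau < t -> t <= T ->
  `|(-1) ^+ m.+1 * LZ u m x t xi tau| <= weight x t xi tau / 2 ^+ m.
Proof.
move=> gu tau0 taut tT; have [_ bm] := gu m.
rewrite normrM normrX normrN1 expr1n mul1r (le_trans (bm _ _ _ _ tau0 taut tT))//.
by rewrite /weight le_eqVlt; apply/orP; left; apply/eqP; ring.
Qed.

Lemma kernel_bound_phi u : good u -> bound mu (2 * B) (phi u).
Proof.
move=> gu x t xi tau tau0 taut tT.
have := geo_bounded_series_tail (fun m => term_le m x xi gu tau0 taut tT) 0.
rewrite [series _ 0%N]/series/= big_geq// subr0 expr0 divr1 => /le_trans; apply.
by rewrite /weight !mulrA.
Qed.

Lemma spacetime_measurable_phi u : good u -> spacetime_measurable T (phi u).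
Proof.
move=> gu; apply: (@measurable_fun_cvg _ _ _ _ (fun n z =>
  series (fun m => (-1) ^+ m.+1 * LZ u m z.1.1 z.1.2 z.2.1 z.2.2) n)).
  elim=> [|n IH].
    by rewrite /series/=; under eq_fun do rewrite big_geq//; exact: measurable_cst.
  under eq_fun do rewrite seriesS; apply: measurable_funD => //.
  by apply: measurable_funM => //; case: (gu n).
move=> [[x t] [xi tau]] /= /and3P[tau0 taut tT].
exact: geo_bounded_series_cvg (fun m => term_le m x xi gu tau0 taut tT).
Qed.

Lemma phi_cvg (u_ : nat -> coeffs R) u x t xi tau :
  (forall n, good (u_ n)) -> 0 <= tau -> tau < t -> t <= T ->
  (forall m, LZ (u_ n) m x t xi tau @[n --> \oo] --> LZ u m x t xi tau) ->
  phi (u_ n) x t xi tau @[n --> \oo] --> phi u x t xi tau.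
Proof.
move=> gu tau0 taut tT cL; apply: geo_bounded_series_lim_cvg.
  by move=> n m; exact: term_le.
by move=> m; apply: cvgMr; exact: cL.
Qed.

End phi_facts.

Variables (vn : nat -> coeffs R) (v : coeffs R).
Hypothesis vnB : forall n, coeff_ball T M lambda alpha (vn n).
Hypothesis vB : coeff_ball T M lambda alpha v.
Hypothesis vn_cvg : forall p, strip T p ->
  [/\ coef_a (vn n) p @[n --> \oo] --> coef_a v p,
      coef_b (vn n) p @[n --> \oo] --> coef_b v p &
      coef_c (vn n) p @[n --> \oo] --> coef_c v p].

Let a_gt0 p : strip T p -> 0 < coef_a v p.
Proof.
by move=> Tp; case: vB => _ [al _]; rewrite (lt_le_trans lambda0)// al.
Qed.

Let Zker_ball_cvg x t xi tau : 0 <= tau -> tau < t -> t <= T ->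
  Zker (vn n) x t xi tau @[n --> \oo] --> Zker v x t xi tau.
Proof.
move=> tau0 taut tT; have st := strip_snd xi taut tau0 tT.
by have [ca _ _] := vn_cvg st; exact: Zker_cvg (a_gt0 st) ca.
Qed.

Let LZ1_ball_cvg x t xi tau : 0 <= tau -> tau < t -> t <= T ->
  LZ1 (vn n) x t xi tau @[n --> \oo] --> LZ1 v x t xi tau.
Proof.
move=> tau0 taut tT; have st := strip_snd xi taut tau0 tT.
have [ca _ _] := vn_cvg st.
have [ca' cb' cc'] := vn_cvg (strip_fst x taut tau0 tT).
exact: LZ1_cvg (a_gt0 st) ca ca' cb' cc'.
Qed.

Lemma Gamma_cvg x t xi tau : 0 <= tau -> tau < t -> t <= T ->
  Gamma (vn n) x t xi tau @[n --> \oo] --> Gamma v x t xi tau.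
Proof.
move=> tau0 taut tT.
have [B [mu [B0 mu0 bLZ1 gLZ]]] := LZ_bounds.
have [BZ BZ0 bZ] := kernel_bound_Zker T0 alpha0 alpha1 lambda0 lambdaM.
have gn n := gLZ _ (vnB n).
(* The pole [(xi, tau)] stays fixed, but the induction must range over all [(y, s)], because the
   convolution evaluates the previous iterate at every intermediate point. *)
have cLZ m y s : tau < s -> s <= T ->
    LZ (vn n) m y s xi tau @[n --> \oo] --> LZ v m y s xi tau.
  elim: m y s => [|m IH] y s taus sT; first exact: LZ1_ball_cvg.
  have B20 : 0 <= B / 2 ^+ m by rewrite divr_ge0// exprn_ge0.
  apply: (stconv_cvg (T := T) M80 be01 mu0 _ _ B0 B20) => //.
  - by move=> n; exact: spacetime_measurable_LZ1 (vnB n).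
  - by move=> n; have [] := gn n m.
  - by move=> n; exact: bLZ1.
  - by move=> n; have [] := gn n m.
  - by move=> z r r0 rs; exact: LZ1_ball_cvg.
apply: cvgD; first exact: Zker_ball_cvg.
have B20 : 0 <= 2 * B by rewrite mulr_ge0.
apply: (stconv_cvg (T := T) M80 be01 mu0 _ _ BZ0 B20) => //.
- by move=> n; exact: spacetime_measurable_Zker (vnB n).
- by move=> n; exact: spacetime_measurable_phi (gn n).
- by move=> n; exact: bZ.
- by move=> n; exact: kernel_bound_phi.
- by move=> y s s0 st; exact: Zker_ball_cvg.
- move=> y s taus sT; apply: (phi_cvg gn) => // m; exact: cLZ.
Qed.

End parametrix_iterates.

Theorem lemma5 (R : realType) (T alpha lambda M : R)
    (T_gt0 : 0 < T) (alpha_gt0 : 0 < alpha) (alpha_le1 : alpha <= 1)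
    (lambda_gt0 : 0 < lambda) (lambda_ltM : lambda < M)
    (vn : nat -> coeffs R) (v : coeffs R)
    (vnB : forall n, coeff_ball T M lambda alpha (vn n))
    (vB : coeff_ball T M lambda alpha v)
    (vn_cvg : forall p, strip T p ->
       [/\ coef_a (vn n) p @[n --> \oo] --> coef_a v p,
           coef_b (vn n) p @[n --> \oo] --> coef_b v p &
           coef_c (vn n) p @[n --> \oo] --> coef_c v p])
    (x t xi tau : R) :
  strip T (x, t) -> strip T (xi, tau) -> tau < t ->
  Gamma (vn n) x t xi tau @[n --> \oo] --> Gamma v x t xi tau.
Proof.
move=> /andP[_ tT] /andP[tau0 _] taut.
exact: (Gamma_cvg T_gt0 alpha_gt0 alpha_le1 lambda_gt0 lambda_ltM vnB vB vn_cvg).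
Qed.
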